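(* Let $d\ge 1$, let $\mathbf{X}=(X_1,\ldots,X_d)$ be a random vector in $\mathbb{R}^d$ with law $\mu$, let $f:\mathbb{R}^d\to\mathbb{R}$ be differentiable, and fix $j\in\{1,\ldots,d\}$. Assume: (A1) $X_1,\ldots,X_d$ are independent; (A2) $\mathbb{E}[f(\mathbf{X})^2]<+\infty$; (A3) $\mathbb{E}\left[\left(\frac{\partial f}{\partial x_j}(\mathbf{X})\right)^2\right]<+\infty$; (A5) the law $\mu_j$ of $X_j$ is a log-concave probability measure on $\mathbb{R}$, i.e. it is absolutely continuous with respect to Lebesgue measure with density $\rho_j(x)=c\exp[-v(x)]$, where $v$ is a continuous convex function on $\mathbb{R}$ and $c$ is a normalizing constant. Let $m$ be the median of $\mu_j$, i.e. such that $\mu_j(X_j\le m)=\mu_j(X_j>m)$. Then $$D_j^{tot}\le\left[\exp(v(m))\right]^2\nu_j ,$$ with $$C_1=\frac{\exp(v(m))}{2}$$ the Cheeger constant of $\mu_j$. Here $\nu_j=\int\left(\frac{\partial f(\mathbf{x})}{\partial x_j}\right)^2 d\mu(\mathbf{x})$, and $D_j^{tot}$ is the (unnormalized) total Sobol' index of $X_j$, i.e. the sum of the variances of all terms involving $X_j$ in the Hoeffding decomposition of $f(\mathbf{X})$.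
   Context: **Boltzmann and log-concave measures.** A probability measure on $\mathbb{R}$ is a Boltzmann measure if it is absolutely continuous with respect to Lebesgue measure with density $\rho(x)=c\exp[-v(x)]$, where $v$ is a continuous function and $c$ a normalizing constant. It is log-concave if moreover $v$ is convex. **Cheeger constant.** For a Boltzmann law $\mu_j$ of $X_j$ with density $\rho_j$ and cumulative distribution function $F_j$, the Cheeger constant is $C_1=\sup_{x\in\mathbb{R}}\frac{\min\left(F_j(x),\,1-F_j(x)\right)}{\rho_j(x)}$. **Hoeffding decomposition.** When $X_1,\ldots,X_d$ are independent and $\mathbb{E}[f(\mathbf{X})^2]<\infty$, one has the unique decomposition $f(\mathbf{X})=\sum_{u\subseteq\{1,\ldots,d\}}f_u(\mathbf{X}_u)$, where $\mathbf{X}_u=(X_i)_{i\in u}$, $f_\emptyset=f_0=\mathbb{E}[f(\mathbf{X})]$ and, recursively, $f_u(\mathbf{X}_u)=\mathbb{E}[f(\mathbf{X})\mid\mathbf{X}_u]-\sum_{w\subsetneq u}f_w(\mathbf{X}_w)$. **Total Sobol' index (unnormalized).** $D_j^{tot}=\sum_{w\subseteq\{1,\ldots,d\},\ w\ni j}\mathbb{E}\left[f_w(\mathbf{X}_w)^2\right]$. **Derivative-based global sensitivity measure (DGSM).** $\nu_j=\mathbb{E}\left[\left(\frac{\partial f}{\partial x_j}(\mathbf{X})\right)^2\right]$.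
   Formalization: For density c·exp(−v) with general c, exp(v(m)) is replaced by exp(v(m))/c in both the bound and the Cheeger constant, since the printed formulas fail for c≠1 (Laplace, c=1/2, f(x)=x); for c=1 they agree. *)

(* Defs.v *)
From HB Require Import structures.
From mathcomp Require Import all_boot all_order all_algebra.
From mathcomp Require Import all_classical all_reals all_analysis.

Set Implicit Arguments.
Unset Strict Implicit.
Unset Printing Implicit Defensive.

Import Order.TTheory GRing.Theory Num.Theory.
Import numFieldNormedType.Exports.

Local Open Scope classical_set_scope.
Local Open Scope ring_scope.

Section log_concave.
Context {R : realType}.

(* c is not assumed to be absorbed into v, so 1 / rho(m) is exp(v(m)) / c, which
   is exp(v(m)) under the normalization c = 1. *)
Definition boltzmann_density (c : R) (v : R -> R) (x : R) : R :=
  c * expR (- v x).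

Definition boltzmann (mu : probability R R)
    (c : R) (v : R -> R) : Prop :=
  [/\ 0 < c, continuous v &
      forall A : set R, measurable A ->
        mu A = (\int[lebesgue_measure]_(x in A) (boltzmann_density c v x)%:E)%E].

Definition log_concave (mu : probability R R)
    (c : R) (v : R -> R) : Prop :=
  boltzmann mu c v /\ convex_function (E := R^o) [set: R^o] v.

Definition is_median (mu : probability R R) (m : R) : Prop :=
  mu `]-oo, m]%classic = mu `]m, +oo[%classic.

(* The supremum is taken in the extended reals: the real-valued [sup] would
   return 0 on an unbounded set. *)
Definition cheeger (mu : probability R R) (rho : R -> R)
    : \bar R :=
  let F x := fine (mu `]-oo, x]%classic) in
  ereal_sup [set (Num.min (F x) (1 - F x) / rho x)%:E | x in [set: R]].

End log_concave.

Section random_vector.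
Context {R : realType} {dT : measure_display} {T : measurableType dT}.
Variables (P : probability T R) (d : nat).
Implicit Types (X : 'I_d -> {RV P >-> R}) (Y Z : T -> R) (u w : {set 'I_d}).

Definition random_vector X (t : T) : 'rV[R]_d := \row_i X i t.

Definition independent X : Prop :=
  forall (u : {set 'I_d}) (A : 'I_d -> set R),
    (forall i, measurable (A i)) ->
    P (\bigcap_(i in [set i | i \in u]) (X i @^-1` A i)) =
    (\prod_(i in u) P (X i @^-1` A i))%E.

(* sigma(X_u); it is the trivial sigma-algebra for u empty *)
Definition sigma_sub X u : set_system T :=
  <<s \bigcup_(i in [set i | i \in u])
        preimage_set_system [set: T] (X i) (@measurable _ R) >>.

(* Z is a version of E[Y | G]. *)
Definition is_cond_exp (G : set_system T) Y Z : Prop :=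
  [/\ (forall B : set R, measurable B -> G (Z @^-1` B)),
      P.-integrable [set: T] (EFin \o Z) &
      forall A, G A -> (\int[P]_(t in A) (Z t)%:E = \int[P]_(t in A) (Y t)%:E)%E].

(* [h u] stands for the random variable f_u(X_u), where Y = f(X). Conditional
   expectations are only determined almost surely, hence so are the [h u].
   For u empty this says that [h u] is the constant E[Y]. *)
Definition hoeffding X Y (h : {set 'I_d} -> T -> R) : Prop :=
  forall u, exists2 Z, is_cond_exp (sigma_sub X u) Y Z &
    forall t, h u t = Z t - \sum_(w : {set 'I_d} | w \proper u) h w t.

Definition sobol_total (h : {set 'I_d} -> T -> R) (j : 'I_d) : \bar R :=
  (\sum_(w : {set 'I_d} | j \in w) 'E_P[fun t => (h w t ^+ 2)%R])%E.

Definition partial (f : 'rV[R]_d -> R) (j : 'I_d) (x : 'rV[R]_d) : R :=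
  'D_(delta_mx 0 j) f x.

Definition dgsm X (f : 'rV[R]_d -> R) (j : 'I_d) : \bar R :=
  'E_P[fun t => partial f j (random_vector X t) ^+ 2].

End random_vector.

(* Main.v *)
(** Write Z_u = E[f(X) | X_u].  Independence makes the conditional expectations
    commute, so that the h_u of the Hoeffding decomposition are pairwise
    orthogonal in L2 and D_j^tot = E[Z^2] - E[Z_{-j}^2], with Z the projection on
    all coordinates.  Hence D_j^tot <= E[(f(X) - W)^2] for every square
    integrable function W of X_{-j}; the choice W = f(X with X_j replaced by m)
    reduces the inequality, by Fubini, to a Poincare inequality on the line
    around the median m.

    On each half-line that inequality is Hardy's: if S is the tail of rho and
    S <= C rho, then (g(x) - g(m))^2 is bounded by
    (int_m^x g'^2 S^(3/2) / rho) (int_m^x rho / S^(3/2)) (Cauchy-Schwarz), the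
    second factor is at most 2 / sqrt S(x), and Tonelli gives the constant
    4 C^2.  Log-concavity makes S / rho nonincreasing to the right of m, so
    C = 1 / (2 rho(m)), which is also the Cheeger constant.

    Since f is only differentiable, the partial derivative need not be locally
    integrable or continuous; all that is needed is
    |g(b) - g(a)| <= int_a^b |g'|, valid for every everywhere differentiable g. *)
Require Import Defs.
From mathcomp Require Import all_boot all_order all_algebra.
From mathcomp Require Import ring lra.
From mathcomp Require Import all_classical all_reals all_analysis.
From mathcomp Require Import measurable_realfun.
Set Implicit Arguments.
Unset Strict Implicit.
Unset Printing Implicit Defensive.
Import Order.TTheory GRing.Theory Num.Theory.
Import numFieldNormedType.Exports.
Local Open Scope classical_set_scope.
Local Open Scope ring_scope.

(** * Increments of everywhere differentiable functions *)

Section everywhere_derivable.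
Context {R : realType}.
Notation mu := (@lebesgue_measure R).
Implicit Types g : R -> R.

Lemma derivable_continuous g : (forall x, derivable g x 1) -> continuous g.
Proof. by move=> dg x; apply: differentiable_continuous; apply/derivable1_diffP. Qed.

(** Sampling the difference quotient at the steps [1 / (n + 1)] makes the derivative a sequential
    limit, which gives measurability, here and later for the partial derivative as a function of all
    coordinates. *)
Lemma cvg_derive1_harmonic g (x : R) : derivable g x 1 ->
  n.+1%:R * (g (n.+1%:R^-1 + x) - g x) @[n --> \oo] --> (derive1 g x : R).
Proof.
rewrite /derivable derive1E /derive.
move/cvgr_dnbhsP => /(_ (fun n => n.+1%:R^-1)) H.
apply: cvg_trans (H _).
  by apply: near_eq_cvg; near=> n; rewrite /= invrK scaler1.
split=> [n|]; first by rewrite invr_eq0 pnatr_eq0.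
exact: cvg_harmonic.
Unshelve. all: by end_near. Qed.

Lemma measurable_derive1 g : (forall x, derivable g x 1) ->
  measurable_fun [set: R] (derive1 g : R -> R).
Proof.
move=> dg; pose h n x := n.+1%:R * (g (n.+1%:R^-1 + x) - g x).
apply: (measurable_fun_cvg (h := h)) => [n|x _]; last exact: cvg_derive1_harmonic.
apply: continuous_measurable_fun => x.
have cg := derivable_continuous dg.
apply: cvgM; first exact: cvg_cst.
apply: cvgB; last exact: cg.
apply: (@cvg_comp _ _ _ (fun y => n.+1%:R^-1 + y) g); last exact: cg.
by apply: cvgD; [exact: cvg_cst|exact: cvg_id].
Qed.

Lemma derive1_right_bound g x (e : R) : derivable g x 1 -> 0 < e ->
  \forall y \near x^'+, `|g y - g x| <= (`|derive1 g x| + e) * (y - x).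
Proof.
move=> dg e0; have := dg; rewrite /derivable derive1E => /cvgrPdist_le.
move=> /(_ _ e0) /nbhs_ballP[r /= r0 H].
near=> y.
have xy : x < y by near: y; exact: nbhs_right_gt.
have yx0 : 0 < y - x by rewrite subr_gt0.
have := H (y - x); rewrite /ball /= sub0r normrN (gtr0_norm yx0) gt_eqF//.
have -> : y - x < r by rewrite ltrBlDl; near: y; apply: nbhs_right_lt; rewrite ltrDl.
move=> /(_ isT isT) /=; rewrite /derive /=.
rewrite [_%:A]mulr1 subrK => K.
have {1}-> : g y - g x = (y - x) * ((y - x)^-1 * (g y - g x)).
  by rewrite mulrA divff ?mul1r ?gt_eqF.
rewrite normrM (gtr0_norm yx0) mulrC ler_pM2r//.
rewrite -lerBlDl (le_trans (lerB_dist _ _))// distrC.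
exact: K.
Unshelve. all: by end_near. Qed.

(* Real induction; no regularity of [g'] is available, so the right-hand side
   [Psi] has to dominate increments of [g] only locally to the right. *)
Lemma local_increment_bound g (Psi : R -> \bar R) (a b : R) : a <= b ->
  continuous g ->
  {homo Psi : x y / x <= y >-> (x <= y)%E} -> (0 <= Psi a)%E ->
  (forall x, a <= x < b -> exists2 d, 0 < d & forall y, x < y < x + d ->
     (Psi x + `|g y - g x|%:E <= Psi y)%E) ->
  (`|g b - g a|%:E <= Psi b)%E.
Proof.
move=> ab cg ndPsi Psi0 loc.
pose A := [set x | a <= x <= b /\ (`|g x - g a|%:E <= Psi x)%E].
have Aa : A a by rewrite /A /= lexx ab subrr normr0.
have Ab : ubound A b by move=> x [/andP[]].
have hA : has_sup A by split; [exists a | exists b].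
pose s := sup A.
have sa : a <= s by apply: ub_le_sup => //; exists b.
have sb : s <= b by apply: sup_le_ub => //; exists a.
(* The supremum belongs to [A]: some [x] of [A] is so near [s] that [g x] is close to [g s], and
   [Psi x <= Psi s]. *)
have As : A s.
  split; first by rewrite sa sb.
  apply/lee_addgt0Pr => e e0.
  have /cvgrPdist_le /(_ _ e0) /nbhs_ballP [r /= r0 H] := cg s.
  have [x Ax sx] := sup_adherent r0 hA.
  have xs : x <= s by apply: ub_le_sup => //; exists b.
  have := H x; rewrite /ball /= ger0_norm ?subr_ge0//.
  rewrite ltrBlDl -ltrBlDr => /(_ sx) Hx.
  have [_ Px] := Ax.
  apply: (@le_trans _ _ (`|g x - g a| + e)%:E).
    by rewrite lee_fin (le_trans (ler_distD (g x) _ _))// [leRHS]addrC lerD2r.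
  by rewrite EFinD leeD2r// (le_trans Px)// ndPsi.
have := sb; rewrite le_eqVlt => /predU1P[<-|slb]; first by case: As.
have [d d0 Hd] : exists2 d, 0 < d & forall y, s < y < s + d ->
     (Psi s + `|g y - g s|%:E <= Psi y)%E by apply: loc; rewrite sa slb.
(* When [s < b], this point beyond [s] is still in [A], a contradiction; the halving secures the
   strict [y < s + d]. *)
pose y := Num.min b (s + d / 2).
have sy : s < y by rewrite /y lt_min slb ltrDl divr_gt0.
have yd : y < s + d by rewrite /y gt_min; apply/orP; right; lra.
have yb : y <= b by rewrite /y ge_min lexx.
have : A y.
  split; first by rewrite yb (le_trans sa)// ltW.
  apply: le_trans (Hd y _); last by rewrite sy yd.
  rewrite (@le_trans _ _ (`|g s - g a|%:E + `|g y - g s|%:E)%E)//.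
    by rewrite -EFinD lee_fin (le_trans (ler_distD (g s) _ _))// [leRHS]addrC.
  by apply: leeD2r; case: As.
move=> Ay; have : y <= s by apply: ub_le_sup => //; exists b.
by rewrite leNgt sy.
Qed.

End everywhere_derivable.

Section increment.
Context {R : realType}.
Notation mu := (@lebesgue_measure R).
Implicit Types g : R -> R.

(** The values of [|g'|] are cut into levels of height [e], and each level set is enclosed in an
    open set of hardly larger measure. The weighted sum [u] of the indicators of these open sets is
    large on a whole neighbourhood of each point, so its primitive dominates the increments of [g]
    locally, while its integral exceeds that of [|g'|] by as little as desired. *)
Lemma increment_le_integral_derive1 g (a b : R) :
  (forall x, derivable g x 1) -> a <= b ->
  (`|g b - g a|%:E <= \int[mu]_(x in `[a, b]) `|derive1 g x|%:E)%E.
Proof.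
move=> dg ab; apply/lee_addgt0Pr => /= e0; move: e0 => /= e0 e00.
(* Makes the total error [2 * e * (b - a) + e] equal to [e0]: the first term comes from the
   discretization into levels, the second from the open sets. *)
pose e : R := e0 / (2 * (b - a) + 1).
have ba1 : 0 < 2 * (b - a) + 1 by lra.
have e_gt0 : 0 < e by rewrite divr_gt0.
pose w (x : R) : R := `|derive1 g x|.
have mw : measurable_fun [set: R] w.
  by apply: measurableT_comp => //; exact: measurable_derive1.
pose E k : set R := `[a, b] `&` w @^-1` `[k%:R * e, k.+1%:R * e[.
have mE k : measurable (E k).
  by apply: measurableI => //; rewrite -[X in measurable X]setTI; exact: mw.
(* On [E k] this gives [w + e < c k <= w + 2 * e]: the lower bound absorbs the error of the local
   estimate, the upper one controls the integral. *)
pose c k : R := (k%:R + 2) * e.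
have c_gt0 k : 0 < c k by rewrite mulr_gt0// ltr_wpDl.
have Efin k : (mu (E k) < +oo)%E.
  apply: (@le_lt_trans _ _ (mu `[a, b])).
    by apply: le_measure; rewrite ?inE; [exact: mE| |exact: subIsetl].
  by rewrite lebesgue_measure_itv/=; case: ifP => // _; rewrite -EFinD ltry.
(* Weighted by [c k], the excess measure of the open set costs at most [e / 2 ^ (k + 1)], and these
   costs sum to at most [e]. *)
pose dl k : R := (e / (2 ^ k.+1)%:R) / c k.
have dl_gt0 k : 0 < dl k by rewrite !divr_gt0.
have /choice[U HU] : forall k, exists U : set R,
    [/\ open U, E k `<=` U & (mu (U `\` E k) < (dl k)%:E)%E].
  move=> k; apply: lebesgue_regularity_outer; [exact: mE|exact: Efin|exact: dl_gt0].
have mU k : measurable (U k).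
  by have [oU _ _] := HU k; exact: open_measurable.
pose u (x : R) : \bar R := (\sum_(0 <= k <oo) (c k * \1_(U k) x)%:E)%E.
have t0 k x : (0 <= (c k * \1_(U k) x)%:E)%E.
  by rewrite lee_fin mulr_ge0// ltW.
have mt k (D : set R) : measurable_fun D (fun x => (c k * \1_(U k) x)%:E).
  by apply/measurable_EFinP; apply: measurable_funM.
have u0 x : (0 <= u x)%E by apply: nneseries_ge0.
have mu_ (D : set R) : measurable_fun D u.
  apply: (@ge0_emeasurable_sum _ _ _ _ _ xpredT) => // k _; exact: mt.
have uc k x : U k x -> ((c k)%:E <= u x)%E.
  move=> Ukx; apply: le_trans (nneseries_lim_ge k.+1 _) => //.
  rewrite big_nat_recr//= indicE mem_set// mulr1.
  by rewrite -[leLHS]add0e leeD2r// sume_ge0.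
pose Psi (x : R) : \bar R := (\int[mu]_(y in `[a, x]) u y)%E.
have -> : e0%:E = ((2 * e) * (b - a) + e)%:E.
  by congr EFin; rewrite /e; field; lra.
apply: (@le_trans _ _ (Psi b)).
- apply: local_increment_bound => //.
  + exact: derivable_continuous.
  + move=> x y xy; apply: ge0_subset_integral => //; first exact: mu_.
    by apply: subset_itv; rewrite bnd_simp.
  + exact: integral_ge0.
  move=> x /andP[ax xb].
  have [k Ekx] : exists k, E k x.
    have we0 : 0 <= w x / e by rewrite divr_ge0 ?normr_ge0 ?(ltW e_gt0).
    exists (Num.trunc (w x / e)).
    split; first by rewrite /= in_itv /= ax ltW.
    have := truncn_itv we0; rewrite /= in_itv/=.
    by rewrite ler_pdivlMr// ltr_pdivrMr.
  have [oU EU _] := HU k.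
  have [d1 /= d10 Hd1] : \forall y \near x^'+, `|g y - g x| <= (w x + e) * (y - x).
    exact: derive1_right_bound.
  have [d2 /= d20 Hd2] : nbhs x (U k).
    by apply: open_nbhs_nbhs; split => //; exact: EU.
  exists (Num.min d1 d2); first by rewrite lt_min d10.
  move=> y /andP[xy]; rewrite -ltrBlDl lt_min => /andP[yd1 yd2].
  have yx0 : 0 < y - x by rewrite subr_gt0.
  have gxy : `|g y - g x| <= c k * (y - x).
    apply: (le_trans (Hd1 y _ _)) => //.
      by rewrite /ball/= distrC gtr0_norm.
    rewrite ler_pM2r//.
    have [_ /=] := Ekx; rewrite in_itv/= => /andP[_ H]; rewrite /c.
    rewrite -natr1 in H; lra.
  (* [Psi y] exceeds [Psi x] by the integral of [u] over []x, y]], and [u >= c k] there because that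
     interval lies in [U k]. *)
  rewrite /Psi (@itv_bndbnd_setU _ _ (BLeft a) (BRight x) (BRight y)) ?bnd_simp//; last exact: ltW.
  rewrite ge0_integral_setU//=; last first.
    by apply: lt_disjoint => p q /=; rewrite !in_itv/= => /andP[_ px] /andP[xq _]; exact: le_lt_trans xq.
    exact: mu_.
  apply: leeD2l => //.
  apply: (@le_trans _ _ (\int[mu]_(_ in `]x, y]) (c k)%:E)%E).
    rewrite integral_cst//= lebesgue_measure_itv/= lte_fin xy -EFinD -EFinM.
    by rewrite lee_fin.
  apply: ge0_le_integral => //.
  - by move=> z _; rewrite lee_fin ltW.
  - exact: mu_.
  move=> z /=; rewrite in_itv/= => /andP[xz zy]; apply: uc; apply: Hd2.
  rewrite /ball/= distrC gtr0_norm ?subr_gt0//; lra.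
rewrite /Psi integral_nneseries//; last by move=> k; exact: mt.
have mwe (D : set R) : measurable_fun D (fun x => (w x + 2 * e)%:E).
  apply: measurable_funTS; apply/measurable_EFinP.
  by apply: measurable_funD => //; exact: measurable_cst.
have we0 x : (0 <= (w x + 2 * e)%:E)%E.
  by rewrite lee_fin; apply: addr_ge0; [exact: normr_ge0|exact: mulr_ge0 (ltW e_gt0)].
have step k : (\int[mu]_(x in `[a, b]) (c k * \1_(U k) x)%:E <=
    \int[mu]_(x in E k) (w x + 2 * e)%:E + (e / (2 ^ k.+1)%:R)%:E)%E.
  under eq_integral do rewrite EFinM.
  rewrite ge0_integralZl_EFin//; [|by apply/measurable_EFinP/measurable_indic; exact: mU|exact: ltW].
  rewrite integral_indic//; last exact: mU.
  apply: (@le_trans _ _ ((c k)%:E * (mu (E k) + (dl k)%:E))%E).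
    rewrite lee_pmul2l ?lte_fin//.
    apply: (@le_trans _ _ (mu (E k `|` (U k `\` E k)))).
      apply: le_measure; rewrite ?inE.
      + by apply: measurableI; [exact: mU|exact: measurable_itv].
      + by apply: measurableU; [exact: mE|apply: measurableD; [exact: mU|exact: mE]].
      + move=> z [Uz _]; have [?|?] := pselect (E k z); [by left|by right].
    apply: (le_trans (measureU2 _ _ _)); [exact: mE|apply: measurableD; [exact: mU|exact: mE]|].
    by apply: leeD2l; have [_ _ /ltW] := HU k.
  rewrite ge0_muleDr//; last by rewrite lee_fin ltW.
  rewrite -EFinM (_ : c k * dl k = e / (2 ^ k.+1)%:R); last first.
    by rewrite /dl mulrCA divff ?mulr1// gt_eqF.
  apply: leeD2r; rewrite -integral_cst//; last exact: mE.
  apply: ge0_le_integral => //.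
  - exact: mE.
  - by move=> x _; rewrite lee_fin ltW.
  - exact: mwe.
  move=> x [_ /=]; rewrite in_itv/= lee_fin => /andP[H _].
  by rewrite /c mulrDl lerD2r.
apply: (le_trans (lee_nneseries _ (fun k _ => step k))).
  by move=> k _ _; exact: integral_ge0.
apply: (le_trans (epsilon_trick _ _ _)).
- by move=> k; exact: integral_ge0.
- exact: ltW.
(* The level sets are disjoint, so the integrals over them add up to one over their union, which is
   contained in [[a, b]]. *)
rewrite -ge0_integral_bigcup//; last first.
  apply/trivIsetP => i k _ _ ik; rewrite -subset0 => x [[_ +] [_ +]] /=.
  rewrite /preimage/= !in_itv/= => /andP[iw wi] /andP[kw wk].
  move: ik; rewrite neq_lt => /orP[|] ik.
    have : i.+1%:R * e <= k%:R * e by rewrite ler_pM2r// ler_nat.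
    lra.
  have : k.+1%:R * e <= i%:R * e by rewrite ler_pM2r// ler_nat.
  lra.
  exact: mwe.
rewrite EFinD addeA; apply: leeD2r.
apply: (@le_trans _ _ (\int[mu]_(x in `[a, b]) (w x + 2 * e)%:E)%E).
  apply: ge0_subset_integral => //.
  - by apply: bigcup_measurable => k _; exact: mE.
  - exact: mwe.
  by move=> x [k _ []].
under eq_integral do rewrite EFinD.
rewrite ge0_integralD//; last 3 first.
- by move=> x _; exact: normr_ge0.
- by apply: measurable_funTS; exact/measurable_EFinP.
- by move=> x _; rewrite lee_fin mulr_ge0// ltW.
apply: leeD2l; rewrite integral_cst//= lebesgue_measure_itv/= lte_fin.
case: ifP => [_|]; first by rewrite -EFinD -EFinM.
by rewrite mule0 lee_fin => _; apply: mulr_ge0; [exact: mulr_ge0 (ltW e_gt0)|rewrite subr_ge0].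
Qed.

End increment.

(** * Hardy's inequality on a half-line *)

Section hardy.
Context {R : realType}.
Notation mu := (@lebesgue_measure R).

(* A Cauchy-Schwarz inequality in which [int_D w] may be infinite: AM-GM gives
   2 w <= (K / A) w^2 p + (A / K) / p pointwise. *)
Lemma sq_le_integral_weight d (T : measurableType d) (nu : {measure set T -> \bar R})
    (D : set T) (w p q : T -> R) (A K : R) :
  measurable D -> measurable_fun D w -> measurable_fun D p ->
  measurable_fun D q ->
  (forall x, D x -> 0 <= w x) -> (forall x, D x -> 0 < p x) ->
  (forall x, D x -> q x = (p x)^-1) ->
  0 <= A -> 0 < K ->
  (A%:E <= \int[nu]_(x in D) (w x)%:E)%E ->
  (\int[nu]_(x in D) (q x)%:E <= K%:E)%E ->
  ((A ^+ 2)%:E <= K%:E * \int[nu]_(x in D) (w x ^+ 2 * p x)%:E)%E.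
Proof.
move=> mD mw mp mq w0 p0 qE A0 K0 Aw pK.
have wp0 x : D x -> (0 <= (w x ^+ 2 * p x)%:E)%E.
  by move=> Dx; rewrite lee_fin mulr_ge0 ?sqr_ge0 ?ltW ?p0.
have q0 x : D x -> (0 <= (q x)%:E)%E.
  by move=> Dx; rewrite lee_fin qE// invr_ge0 ltW ?p0.
have mwp : measurable_fun D (fun x => (w x ^+ 2 * p x)%:E).
  by apply/measurable_EFinP; apply: measurable_funM => //; exact: measurable_funX.
have mq' : measurable_fun D (EFin \o q) by exact/measurable_EFinP.
(* The weights of the AM-GM inequality divide by [A], so [A = 0] is set apart. *)
move: A0; rewrite le_eqVlt => /predU1P[<-|A0].
  by rewrite expr0n/=; apply: mule_ge0; [rewrite lee_fin ltW|exact: integral_ge0].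
have H : ((2 * A)%:E <= (K / A)%:E * (\int[nu]_(x in D) (w x ^+ 2 * p x)%:E) + A%:E)%E.
  apply: (@le_trans _ _ (\int[nu]_(x in D) ((K / A)%:E * (w x ^+ 2 * p x)%:E + (A / K)%:E * (q x)%:E))%E).
    rewrite EFinM; apply: (@le_trans _ _ (\int[nu]_(x in D) (2%:E * (w x)%:E))%E).
      rewrite ge0_integralZl_EFin//; last exact/measurable_EFinP.
      by rewrite lee_pmul2l ?lte_fin.
    apply: ge0_le_integral => //.
    - by move=> x Dx; rewrite -EFinM lee_fin mulr_ge0 ?w0.
    - apply/measurable_EFinP; apply: measurable_funM => //.
    - by apply: emeasurable_funD; apply: measurable_funeM.
    move=> x Dx; rewrite -!EFinM -EFinD lee_fin qE//.
    have px := p0 x Dx.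
    rewrite -subr_ge0.
    have -> : K / A * (w x ^+ 2 * p x) + A / K * (p x)^-1 - 2 * w x =
      (K * p x * w x - A) ^+ 2 / (A * K * p x).
      by field; rewrite !gt_eqF.
    by rewrite divr_ge0 ?sqr_ge0// ltW// !mulr_gt0.
  rewrite ge0_integralD//; first last.
  - by apply: measurable_funeM.
  - by move=> x Dx; rewrite mule_ge0 ?q0 ?lee_fin ?divr_ge0 ?ltW.
  - by apply: measurable_funeM.
  - by move=> x Dx; rewrite mule_ge0 ?wp0 ?lee_fin ?divr_ge0 ?ltW.
  rewrite !ge0_integralZl_EFin ?divr_ge0 ?(ltW A0) ?(ltW K0)//.
  apply: leeD2l.
  rewrite (_ : A%:E = (A / K)%:E * K%:E)%E; last first.
    by rewrite -EFinM -mulrA mulVf ?mulr1// gt_eqF.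
  by rewrite lee_pmul2l// lte_fin divr_gt0.
(* Cancelling [A] is legitimate even if the integral is infinite, since [A] itself is finite. *)
have : (A%:E <= (K / A)%:E * (\int[nu]_(x in D) (w x ^+ 2 * p x)%:E))%E.
  rewrite -(@leeD2rE _ A%:E)// -EFinD.
  by rewrite (_ : A + A = 2 * A)// mulr_natl.
rewrite -(@lee_pmul2l _ A%:E)// ?lte_fin//.
by rewrite muleA -!EFinM -expr2 mulrCA divff ?mulr1 // gt_eqF.
Qed.

(** The first coordinate carries the point [x] of the outer integral, the second the point [t]
    between [m] and [x]. *)
Definition triangle (m : R) : set (R * R) := [set z | m <= z.2 /\ z.2 <= z.1].

Lemma measurable_triangle m : measurable (triangle m).
Proof.
rewrite (_ : triangle m = [set z | m <= z.2] `&` [set z | z.2 <= z.1])//.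
apply: measurableI; rewrite -[X in measurable X]setTI;
  exact: measurable_fun_le.
Qed.

(** Trades a moving domain for a fixed one, so that measurability in the endpoint follows from
    Tonelli's theorem on the plane. *)
Lemma integral_triangle_section m (G : R -> \bar R) x :
  (\int[mu]_(t in `[m, x]) G t = \int[mu]_t ((G \o snd) \_ (triangle m)) (x, t))%E.
Proof.
rewrite integral_mkcond; apply: eq_integral => t _.
rewrite !patchE/=; congr (if _ then _ else _).
by apply/idP/idP; rewrite !inE/= in_itv/= => /andP.
Qed.

Lemma measurable_integral_itvcc (m : R) (G : R -> \bar R) :
  measurable_fun [set: R] G -> (forall x, 0 <= G x)%E ->
  measurable_fun [set: R] (fun x => \int[mu]_(t in `[m, x]) G t)%E.
Proof.
move=> mG G0; under eq_fun do rewrite integral_triangle_section.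
have mF : measurable_fun [set: R * R] ((G \o snd) \_ (triangle m)).
  apply: (iffLR (measurable_restrictT _ (measurable_triangle m))); apply: measurable_funTS.
  exact: measurableT_comp.
have F0 z : (0 <= ((G \o snd) \_ (triangle m)) z)%E.
  by rewrite patchE; case: ifP => // _; exact: G0.
exact: (@measurable_fun_fubini_tonelli_F _ _ (measurableTypeR R)
  (measurableTypeR R) R lebesgue_measure _ mF F0).
Qed.

Lemma measurable_integral_itvcy (H : R -> \bar R) :
  measurable_fun [set: R] H -> (forall x, 0 <= H x)%E ->
  measurable_fun [set: R] (fun t => \int[mu]_(x in `[t, +oo[) H x)%E.
Proof.
move=> mH H0; pose A : set (R * R) := [set z | z.2 <= z.1].
have mA : measurable A.
  by rewrite -[X in measurable X]setTI; exact: measurable_fun_le.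
have mF : measurable_fun [set: R * R] ((H \o fst) \_ A).
  apply: (iffLR (measurable_restrictT _ mA)); apply: measurable_funTS.
  exact: measurableT_comp.
have F0 z : (0 <= ((H \o fst) \_ A) z)%E.
  by rewrite patchE; case: ifP => // _; exact: H0.
have := @measurable_fun_fubini_tonelli_G _ _ (measurableTypeR R)
  (measurableTypeR R) R lebesgue_measure _ mF F0.
congr (measurable_fun _ _); apply/funext => t.
rewrite /fubini_G [RHS]integral_mkcond; apply: eq_integral => x _.
rewrite !patchE/=; congr (if _ then _ else _).
by apply/idP/idP; rewrite !inE/= in_itv/= andbT.
Qed.

(** Both sides are iterated integrals of [H x * G t] over the region [m <= t <= x]. *)
Lemma triangle_tonelli (m : R) (G H : R -> \bar R) :
  measurable_fun [set: R] G -> measurable_fun [set: R] H ->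
  (forall x, 0 <= G x)%E -> (forall x, 0 <= H x)%E ->
  (\int[mu]_(x in `[m, +oo[) (H x * \int[mu]_(t in `[m, x]) G t) =
   \int[mu]_(t in `[m, +oo[) (G t * \int[mu]_(x in `[t, +oo[) H x))%E.
Proof.
move=> mG mH G0 H0.
pose F := (fun z : R * R => H z.1 * G z.2)%E \_ (triangle m).
have mF : measurable_fun [set: R * R] F.
  apply: (iffLR (measurable_restrictT _ (measurable_triangle m))); apply: measurable_funTS.
  by apply: emeasurable_funM; apply: measurableT_comp.
have F0 z : (0 <= F z)%E.
  by rewrite /F patchE; case: ifP => // _; exact: mule_ge0.
transitivity (\int[mu]_x \int[mu]_t F (x, t))%E.
  rewrite integral_mkcond; apply: eq_integral => x _; rewrite patchE.
  case: ifPn => [_|].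
    rewrite -ge0_integralZl//; last 1 first.
      exact: measurable_funTS.
    rewrite integral_mkcond; apply: eq_integral => t _.
    rewrite /F !patchE/=; congr (if _ then _ else _).
    by apply/idP/idP; rewrite !inE/= in_itv/= => /andP.
  rewrite notin_setE/= in_itv/= andbT => /negP; rewrite -ltNge => xm.
  rewrite integral0_eq// => t _; rewrite /F patchE ifF//.
  by apply/negbTE; rewrite notin_setE/= => -[mt tx]; move: xm; rewrite ltNge (le_trans mt).
rewrite fubini_tonelli//.
rewrite [RHS]integral_mkcond; apply: eq_integral => t _; rewrite patchE.
case: ifPn => [|].
  rewrite inE/= in_itv/= andbT => mt.
  rewrite -ge0_integralZl//; last 1 first.
    exact: measurable_funTS.
  rewrite [RHS]integral_mkcond; apply: eq_integral => x _.
  rewrite /F !patchE/= muleC; congr (if _ then _ else _).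
  by apply/idP/idP; rewrite !inE/= in_itv/= andbT => // -[].
rewrite notin_setE/= in_itv/= andbT => /negP; rewrite -ltNge => tm.
rewrite integral0_eq// => x _; rewrite /F patchE ifF//.
by apply/negbTE; rewrite notin_setE/= => -[mt tx]; move: tm; rewrite ltNge mt.
Qed.

Lemma integral_itvcy_le (f : R -> R) (a K : R) : measurable_fun [set: R] f ->
  (forall x, 0 <= f x) ->
  (forall b, a < b -> (\int[mu]_(x in `[a, b]) (f x)%:E <= K%:E)%E) ->
  (\int[mu]_(x in `[a, +oo[) (f x)%:E <= K%:E)%E.
Proof.
move=> mf f0 H.
(* The [+ 1] keeps the right endpoint above [a] at [n = 0], as [H] requires [a < b]. *)
pose D (n : nat) : set R := `[a, a + n%:R + 1]%classic.
have DE : \bigcup_i D i = `[a, +oo[%classic.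
  apply/seteqP; split=> [x [n _]|x] /=; rewrite !in_itv/= ?andbT.
    by move=> /andP[].
  move=> ax; exists (Num.trunc (x - a)) => //=.
  rewrite /D/= in_itv/= ax/=.
  have /truncn_itv/andP[_] : 0 <= x - a by rewrite subr_ge0.
  by rewrite -natr1; lra.
have L : (\int[mu]_(x in D n) (f x)%:E)%E @[n --> \oo] -->
    (\int[mu]_(x in `[a, +oo[) (f x)%:E)%E.
  rewrite -DE; apply: ge0_nondecreasing_set_cvg_integral.
  - move=> n k nk; rewrite subsetEset; apply: subset_itv; rewrite bnd_simp//.
    by rewrite lerD2r lerD2l ler_nat.
  - by move=> n; exact: measurable_itv.
  - by move=> n; apply: measurable_funTS; exact/measurable_EFinP.
  - by move=> n x _; rewrite /= lee_fin.
rewrite -(cvg_lim _ L)//; apply: lime_le; first by apply/cvg_ex; eexists; exact: L.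
by apply: nearW => n; apply: H; rewrite -addrA ltrDl ltr_wpDl.
Qed.

(** A uniform bound on the increments of the antiderivative stands in for its limit at infinity. *)
Lemma integral_derive_le (F f : R -> R) (a K : R) :
  continuous f -> (forall x, 0 <= f x) ->
  (forall x : R, is_derive x 1 F (f x)) -> (forall x, a <= x -> F x - F a <= K) ->
  (\int[mu]_(x in `[a, +oo[) (f x)%:E <= K%:E)%E.
Proof.
move=> cf f0 dF FK; apply: integral_itvcy_le => //.
  exact: continuous_measurable_fun.
move=> b ab; rewrite (@continuous_FTC2 _ f F)//.
- by rewrite -EFinB lee_fin FK// ltW.
- exact: continuous_subspaceT.
- have cF : continuous F.
    by apply: derivable_continuous => x; have [] := dF x.
  split=> [x _| |]; first by have [] := dF x.
    exact/cvg_at_right_filter/cF.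
  exact/cvg_at_left_filter/cF.
- by move=> x _; rewrite derive1E; have [] := dF x.
Qed.

(** The power [3/2] makes every integral explicit. With [Q = sqrt S], the weight [q] has
    antiderivative [2 / Q], the resulting [r = rho * (2 / Q)] has antiderivative [-4 * Q], and the
    factor left at the end is [4 * Q / q = 4 * S^2 / rho <= 4 * C^2 * rho]. *)
Lemma hardy_half_line (rho S g : R -> R) (m C : R) :
  continuous rho -> (forall x, 0 < rho x) -> (forall x, 0 < S x) ->
  (forall x : R, is_derive x 1 S (- rho x)) ->
  (forall x, m <= x -> S x <= C * rho x) ->
  (forall x, derivable g x 1) ->
  (\int[mu]_(x in `[m, +oo[) ((g x - g m) ^+ 2 * rho x)%:E <=
   (4 * C ^+ 2)%:E * \int[mu]_(x in `[m, +oo[) (derive1 g x ^+ 2 * rho x)%:E)%E.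
Proof.
move=> crho rho0 S0 dS SC dg.
pose Q x := Num.sqrt (S x).
have Q0 x : 0 < Q x by rewrite sqrtr_gt0.
have SQ x : S x = Q x ^+ 2 by rewrite sqr_sqrtr// ltW.
have dQ (x : R) : is_derive x 1 Q (- (rho x / (2 * Q x))).
  apply: (is_derive_eq (is_derive1_comp (is_derive1_sqrt (S0 x)) (dS x))).
  by rewrite mulrN mulrC.
have cQ : continuous Q.
  by apply: derivable_continuous => x; have [] := dQ x.
pose q x := rho x / Q x ^+ 3.
have Q3 x : Q x ^+ 3 != 0 by rewrite gt_eqF// exprn_gt0.
have cq : continuous q.
  move=> x; apply: cvgM; first exact: crho.
  by apply: cvgV => //; apply: (@cvg_comp _ _ _ Q (fun y => y ^+ 3)); [exact: cQ|exact: exprn_continuous].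
pose p x := (q x)^-1.
have q0 x : 0 < q x by rewrite divr_gt0 ?exprn_gt0.
have p0 x : 0 < p x by rewrite invr_gt0.
have cp : continuous p by move=> x; apply: cvgV; [rewrite gt_eqF|exact: cq].
pose r x := 2 * rho x / Q x.
have r0 x : 0 < r x by rewrite divr_gt0 ?mulr_gt0.
have cr : continuous r.
  move=> x; apply: cvgM; last by apply: cvgV; [rewrite gt_eqF|exact: cQ].
  by apply: cvgM; [exact: cvg_cst|exact: crho].
pose w x := `|derive1 g x|.
have mw : measurable_fun [set: R] w.
  by apply: measurableT_comp => //; exact: measurable_derive1.
have mC (f : R -> R) (D : set R) : continuous f -> measurable_fun D f.
  by move=> cf; apply: measurable_funTS; exact: continuous_measurable_fun.
have wp0 x : (0 <= (w x ^+ 2 * p x)%:E)%E by rewrite lee_fin mulr_ge0 ?sqr_ge0 ?ltW.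
have mrE : measurable_fun [set: R] (EFin \o r) by apply/measurable_EFinP; exact: mC.
have mwpE : measurable_fun [set: R] (fun x => (w x ^+ 2 * p x)%:E).
  apply/measurable_EFinP; apply: measurable_funM; last exact: mC.
  exact: measurable_funX.
have pointwise x : m <= x ->
    (((g x - g m) ^+ 2)%:E <= (2 / Q x)%:E * \int[mu]_(t in `[m, x]) (w t ^+ 2 * p t)%:E)%E.
  move=> mx; rewrite -[(_ - _) ^+ 2]real_normK ?num_real//.
  apply: (@sq_le_integral_weight _ _ mu `[m, x]%classic w p q) => //.
  - exact: measurable_funTS.
  - exact: mC.
  - exact: mC.
  - by move=> ? _; exact: normr_ge0.
  - by move=> ? _; rewrite /p invrK.
  - by rewrite divr_gt0.
  - exact: increment_le_integral_derive1.
  (* It remains to bound the integral of [q] over [[m, x]], equal to [2 / Q x - 2 / Q m]. The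
     fundamental theorem asks for [m < x], hence the separate case. *)
  have := mx; rewrite le_eqVlt => /predU1P[<-|mx'].
    by rewrite set_itv1 integral_set1 lee_fin divr_ge0 ?ltW.
  have dF (y : R) : is_derive y 1 (fun y => 2 / Q y) (q y).
    have Qy : Q y != 0 by rewrite gt_eqF.
    apply: (is_derive_eq (is_deriveZ 2 (is_deriveV Qy (dQ y)))).
    by rewrite /q /GRing.scale/=; field.
  rewrite (@continuous_FTC2 _ q (fun y => 2 / Q y))//.
  - by rewrite -EFinB lee_fin gerBl divr_ge0 ?ltW.
  - exact: continuous_subspaceT.
  - have cF : continuous (fun y => 2 / Q y).
      by apply: derivable_continuous => y; have [] := dF y.
    split=> [y _| |]; first by have [] := dF y.
      exact/cvg_at_right_filter/cF.
    exact/cvg_at_left_filter/cF.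
  - by move=> y _; rewrite derive1E; have [] := dF y.
apply: (@le_trans _ _ (\int[mu]_(x in `[m, +oo[)
    ((r x)%:E * \int[mu]_(t in `[m, x]) (w t ^+ 2 * p t)%:E))%E).
  apply: ge0_le_integral => //.
  - by move=> x _; rewrite lee_fin mulr_ge0 ?sqr_ge0 ?ltW.
  - apply/measurable_EFinP; apply: mC => x.
    apply: cvgM; last exact: crho.
    apply: (@cvg_comp _ _ _ (fun x => g x - g m) (fun y => y ^+ 2)); last exact: exprn_continuous.
    by apply: cvgB; [exact: derivable_continuous|exact: cvg_cst].
  - apply: emeasurable_funM; apply: measurable_funTS; first by apply/measurable_EFinP; exact: mC.
    exact: (@measurable_integral_itvcc m (fun t => (w t ^+ 2 * p t)%:E)).
  - move=> x /=; rewrite in_itv/= andbT => mx.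
    rewrite mulrC EFinM (_ : r x = rho x * (2 / Q x)); last by rewrite /r; ring.
    rewrite [X in (_ <= X * _)%E]EFinM -muleA lee_pmul2l ?lte_fin//.
    exact: pointwise.
(* Exchanging the integrals leaves, at each [t], the integral of [r] over [[t, +oo[], bounded by
   [4 * Q t]. *)
rewrite (@triangle_tonelli m (fun t => (w t ^+ 2 * p t)%:E) (EFin \o r))//; last first.
  by move=> x; rewrite lee_fin ltW.
rewrite -ge0_integralZl_EFin//.
- apply: ge0_le_integral => //.
  + by move=> x _; rewrite mule_ge0//; apply: integral_ge0 => y _; rewrite lee_fin ltW.
  + apply: emeasurable_funM; apply: measurable_funTS; first exact: mwpE.
    by apply: (@measurable_integral_itvcy (EFin \o r)) => // x; rewrite lee_fin ltW.
  + apply: measurable_funeM; apply/measurable_EFinP; apply: measurable_funM; last exact: mC.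
    by apply: measurable_funX; apply: measurable_funTS; exact: measurable_derive1.
  move=> t /=; rewrite in_itv/= andbT => mt.
  have H : (\int[mu]_(x in `[t, +oo[) (r x)%:E <= (4 * Q t)%:E)%E.
    apply: (@integral_derive_le (fun y => - 4 * Q y)) => //.
    + by move=> x; exact: ltW.
    + move=> y; apply: (is_derive_eq (is_deriveZ (- 4) (dQ y))).
      by rewrite /r /GRing.scale/=; field; rewrite gt_eqF.
    + by move=> x _; have := Q0 x; lra.
  apply: (@le_trans _ _ ((w t ^+ 2 * p t)%:E * (4 * Q t)%:E)%E).
    by apply: lee_wpmul2l.
  rewrite -!EFinM lee_fin /w real_normK ?num_real//.
  have -> : derive1 g t ^+ 2 * p t * (4 * Q t) = 4 * (S t ^+ 2 / rho t) * derive1 g t ^+ 2.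
    by rewrite SQ /p /q; field; rewrite !gt_eqF.
  have SCt : S t ^+ 2 / rho t <= C ^+ 2 * rho t.
    rewrite ler_pdivrMr// -mulrA -expr2 -exprMn.
    by rewrite ler_sqr ?nnegrE ?(ltW (S0 t)) ?SC// (le_trans (ltW (S0 t)))// SC.
  have := ler_wpM2r (sqr_ge0 (derive1 g t)) SCt; lra.
- by move=> x _; rewrite lee_fin mulr_ge0 ?sqr_ge0 ?ltW.
- apply/measurable_EFinP; apply: measurable_funM; last exact: mC.
  by apply: measurable_funX; apply: measurable_funTS; exact: measurable_derive1.
- by rewrite mulr_ge0// sqr_ge0.
Qed.

End hardy.

(** * Integration against a density *)

Section integral_density.
Context {d d'} {T : measurableType d} {Y : measurableType d'} {R : realType}.
Variables (m : {measure set T -> \bar R}) (phi : T -> Y) (rho : T -> R).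
Hypotheses (mphi : measurable_fun [set: T] phi)
  (mrho : measurable_fun [set: T] rho) (rho0 : forall x, 0 <= rho x).
Import HBNNSimple.

(** The right-hand side sees [phi] and [rho] only through the integrals of [rho] over preimages of
    measurable sets, as the approximating simple functions depend on [f] alone. *)
Lemma integral_density_simple (f : Y -> \bar R) (mf : measurable_fun [set: Y] f) :
  (forall y, 0 <= f y)%E ->
  (\int[m]_x (f (phi x) * (rho x)%:E) =
   limn (fun n => let h := nnsfun_approx measurableT mf n in
     \sum_(y \in range h)
        (y%:E * \int[m]_(x in phi @^-1` (h @^-1` [set y])) (rho x)%:E)))%E.
Proof.
move=> f0; pose h := nnsfun_approx measurableT mf.
have mrE D : measurable_fun D (EFin \o rho).
  by apply: measurable_funTS; exact/measurable_EFinP.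
have fE x : (f (phi x) * (rho x)%:E =
    limn (fun n => (h n (phi x))%:E * (rho x)%:E))%E.
  apply/esym/cvg_lim => //; apply: cvgeZr => //.
  exact: (cvg_nnsfun_approx measurableT mf (fun y _ => f0 y)).
under eq_integral do rewrite fE.
rewrite monotone_convergence//; last 3 first.
- move=> n; apply: emeasurable_funM; last exact: mrE.
  by apply/measurable_EFinP; apply: measurableT_comp.
- by move=> n x _; rewrite mule_ge0// lee_fin.
- move=> x _ a b ab; rewrite lee_wpmul2r ?lee_fin//.
  exact/lefP/(nd_nnsfun_approx measurableT mf).
congr (limn _); apply/funext => n /=.
have mA y : measurable (phi @^-1` (h n @^-1` [set y])).
  by rewrite -[X in measurable X]setTI; apply: mphi => //.
have hE x : ((h n (phi x))%:E * (rho x)%:E =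
    \sum_(y \in range (h n)) ((y * \1_(h n @^-1` [set y]) (phi x))%:E * (rho x)%:E))%E.
  rewrite fimfunE -fsumEFin// ge0_mule_fsuml//.
  by move=> y; exact: nnfun_muleindic_ge0.
under eq_integral do rewrite hE.
rewrite ge0_integral_fsum//; last 2 first.
- move=> y; apply: emeasurable_funM; last exact: mrE.
  apply/measurable_EFinP; apply: measurable_funM => //.
  by apply: (@measurableT_comp _ _ _ _ _ _ (\1_(h n @^-1` [set y]) : Y -> R)).
- move=> y x _; apply: mule_ge0; last by rewrite lee_fin.
  exact: nnfun_muleindic_ge0.
apply: eq_fsbigr => y _.
(* A constant [y >= 0] can be pulled out of the integral; a negative [y] is not a value of [h n],
   and both sides vanish. *)
have [y0|y0] := ltP y 0.
  have e0 : h n @^-1` [set y] = set0.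
    by apply/seteqP; split=> // z /= hy; move: y0; rewrite -hy ltNge fun_ge0.
  rewrite -/h e0 preimage_set0 integral_set0 mule0 integral0_eq// => x _.
  by rewrite indic0 mulr0 mul0e.
rewrite -ge0_integralZl_EFin;
  [|exact: mA|by move=> ? _; rewrite lee_fin|exact: mrE|exact: y0].
rewrite [RHS]integral_mkcond; apply: eq_integral => x _.
rewrite patchE indicE -/h; case: ifPn => [|]; rewrite ?inE ?notin_setE => hx.
  by rewrite mem_set// mulr1.
by rewrite memNset// mulr0 mul0e.
Qed.

End integral_density.

Section eq_integral_density.
Import HBNNSimple.

(** Agreement on measurable sets extends to nonnegative functions. This serves both for integrating
    against a density and for testing a signed density against functions. *)
Lemma eq_integral_density d1 d2 d (T1 : measurableType d1) (T2 : measurableType d2)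
    (Y : measurableType d) (R : realType)
    (m1 : {measure set T1 -> \bar R}) (m2 : {measure set T2 -> \bar R})
    (phi1 : T1 -> Y) (phi2 : T2 -> Y) (rho1 : T1 -> R) (rho2 : T2 -> R)
    (f : Y -> \bar R) :
  measurable_fun [set: T1] phi1 -> measurable_fun [set: T2] phi2 ->
  measurable_fun [set: T1] rho1 -> measurable_fun [set: T2] rho2 ->
  (forall x, 0 <= rho1 x) -> (forall x, 0 <= rho2 x) ->
  (forall A, measurable A ->
    \int[m1]_(x in phi1 @^-1` A) (rho1 x)%:E =
    \int[m2]_(x in phi2 @^-1` A) (rho2 x)%:E)%E ->
  measurable_fun [set: Y] f -> (forall y, 0 <= f y)%E ->
  (\int[m1]_x (f (phi1 x) * (rho1 x)%:E) = \int[m2]_x (f (phi2 x) * (rho2 x)%:E))%E.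
Proof.
move=> mphi1 mphi2 mrho1 mrho2 rho10 rho20 E mf f0.
rewrite (integral_density_simple m1 mphi1 mrho1 rho10 mf)//.
rewrite (integral_density_simple m2 mphi2 mrho2 rho20 mf)//.
congr (limn _); apply/funext => n /=; apply: eq_fsbigr => y _.
by rewrite E.
Qed.

End eq_integral_density.

Lemma integral_density (R : realType) (nu : {measure set R -> \bar R})
    (rho : R -> R) (f : R -> \bar R) :
  measurable_fun [set: R] rho -> (forall x, 0 <= rho x) ->
  (forall A, measurable A -> nu A = \int[lebesgue_measure]_(x in A) (rho x)%:E)%E ->
  measurable_fun [set: R] f -> (forall y, 0 <= f y)%E ->
  (\int[nu]_x f x = \int[lebesgue_measure]_x (f x * (rho x)%:E))%E.
Proof.
move=> mrho rho0 E mf f0.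
rewrite -(@eq_integral_density _ _ _ R (measurableTypeR R) R R nu
  lebesgue_measure id id (cst 1) rho)//.
  by under eq_integral do rewrite mule1.
by move=> A mA; rewrite -E// preimage_id (integral_cst nu mA 1%E) mul1e.
Qed.

(** * Reflection and translation of integrals on the line *)

Section reflection.
Context {R : realType}.
Notation mu := (@lebesgue_measure R).

Lemma ge0_integral_opp (A : set R) (f : R -> \bar R) :
  measurable A -> measurable_fun [set: R] f -> (forall x, 0 <= f x)%E ->
  (\int[mu]_(x in A) f x = \int[mu]_(x in -%R @^-1` A) f (- x)%R)%E.
Proof.
move=> mA mf f0.
rewrite -(@ge0_integral_pushforward _ _ (measurableTypeR R) (measurableTypeR R)
  R -%R _ mu A f)//.
- by apply: eq_measure_integral => //= B mB BA; exact/esym/lebesgue_measureN.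
- exact: measurable_funTS.
Qed.

(** Translation invariance, from the uniqueness of Lebesgue measure: the preimage of an interval has
    the same length. *)
Lemma ge0_integral_shift (a m : R) (f : R -> \bar R) :
  measurable_fun [set: R] f -> (forall x, 0 <= f x)%E ->
  (\int[mu]_(x in `[(m + a)%R, +oo[) f x = \int[mu]_(x in `[m, +oo[) f (x + a)%R)%E.
Proof.
move=> mf f0.
rewrite (_ : `[m, +oo[%classic = (fun x : R => x + a) @^-1` `[m + a, +oo[); last first.
  by apply/seteqP; split=> x /=; rewrite !in_itv/= !andbT lerD2r.
have mt : measurable_fun [set: measurableTypeR R] ((fun x => x + a) : _ -> measurableTypeR R).
  by apply: measurable_funD => //; exact: measurable_cst.
rewrite -(@ge0_integral_pushforward _ _ (measurableTypeR R) (measurableTypeR R)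
  R (fun x => x + a) mt mu _ f)//; last exact: measurable_funTS.
apply: eq_measure_integral => //= B mB _.
apply: lebesgue_measure_unique => // _ [[p q]] _ <- /=.
rewrite /pushforward (_ : _ @^-1` _ = `]p - a, q - a]%classic); last first.
  by apply/seteqP; split=> x /=; rewrite !in_itv/= ltrBlDr lerBrDr.
by rewrite !lebesgue_measure_itv/= !lte_fin ltrD2r -!EFinB opprB addrA subrK.
Qed.

End reflection.

(** * Log-concave measures on the line *)

Section log_concave_density.
Context {R : realType}.
Notation mu := (@lebesgue_measure R).
Implicit Types (rho g : R -> R).

(* [log rho] has nonincreasing increments *)
Definition log_concave_density rho := forall m y a : R, m <= y -> 0 <= a ->
  rho (y + a) * rho m <= rho (m + a) * rho y.

(** Both [y] and [m + a] lie between [m] and [y + a], with the weights [t] and [1 - t] exchanged, so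
    the two convexity inequalities add up to the claim. *)
Lemma convex_increment (v : R -> R) (m y a : R) :
  convex_function (E := R^o) [set: R^o] v -> m <= y -> 0 <= a ->
  v (m + a) + v y <= v (y + a) + v m.
Proof.
move=> cv; rewrite le_eqVlt => /predU1P[->|my] a0; first by rewrite addrC.
have L0 : 0 < y + a - m by lra.
pose t := (y - m) / (y + a - m).
have t0 : 0 <= t by rewrite divr_ge0; lra.
have t1 : t <= 1 by rewrite ler_pdivrMr// mul1r; lra.
have tL : t * (y + a - m) = y - m by rewrite divfK// gt_eqF.
have cvt p q : v (t * p + (1 - t) * q) <= t * v p + (1 - t) * v q.
  by apply: (cv (Itv01 t0 t1) p q); rewrite inE.
have := cvt m (y + a); have := cvt (y + a) m.
have -> : t * (y + a) + (1 - t) * m = y by move: tL; lra.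
have -> : t * m + (1 - t) * (y + a) = m + a by move: tL; lra.
lra.
Qed.

Lemma convex_log_concave_density (c : R) (v : R -> R) : 0 < c ->
  convex_function (E := R^o) [set: R^o] v ->
  log_concave_density (boltzmann_density c v).
Proof.
move=> c0 cv m y a my a0; rewrite /boltzmann_density.
rewrite mulrACA -expRD [leRHS]mulrACA -expRD ler_pM2l ?mulr_gt0// ler_expR.
by have := convex_increment cv my a0; lra.
Qed.

Lemma log_concave_density_opp rho : log_concave_density rho ->
  log_concave_density (fun x => rho (- x)).
Proof.
move=> lc m y a my a0 /=.
(* Reflection reverses the order: the pair to use is [-y - a <= -m - a], whose shifts by [a] are
   [-y] and [-m]. *)
have := lc (- y - a) (- m - a) a; rewrite !subrK lerD2r lerN2 !opprD.
by move=> /(_ my a0); lra.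
Qed.

(** * Tail bound and Poincare inequality to the right of [m] *)

Section right.
Variables (rho : R -> R) (m : R).
Hypotheses (crho : continuous rho) (rho0 : forall x, 0 < rho x)
  (lc : log_concave_density rho)
  (intrho : mu.-integrable [set: R] (EFin \o rho)).

(** On [[m, +oo[] the ratio of tail to density is largest at [m]: after translating the tail from
    [x] back to [m], log-concavity gives [rho (y + (x - m)) <= rho x / rho m * rho y] pointwise. *)
Lemma tail_le_density (x : R) : m <= x ->
  (\int[mu]_(y in `[x, +oo[) (rho y)%:E <=
   (rho x / rho m)%:E * \int[mu]_(y in `[m, +oo[) (rho y)%:E)%E.
Proof.
move=> mx.
have mrho (D : set R) : measurable_fun D (EFin \o rho).
  by apply: measurable_funTS; apply/measurable_EFinP; exact: continuous_measurable_fun.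
have xE : x = m + (x - m) by rewrite addrC subrK.
rewrite {1}xE ge0_integral_shift//; last by move=> z; rewrite lee_fin ltW.
rewrite -ge0_integralZl_EFin//.
- apply: ge0_le_integral => //.
  + by move=> z _; rewrite lee_fin ltW.
  + apply: measurable_funTS; apply/measurable_EFinP.
    apply: (@measurableT_comp _ _ _ _ _ _ rho); first exact: continuous_measurable_fun.
    by apply: measurable_funD => //; exact: measurable_cst.
  + by apply: measurable_funeM; exact: mrho.
  move=> y /=; rewrite in_itv/= andbT => my.
  rewrite -EFinM lee_fin mulrAC ler_pdivlMr//.
  by have := lc my (_ : 0 <= x - m); rewrite -xE; apply; rewrite subr_ge0.
- by move=> z _; rewrite lee_fin ltW.
- by exact: mrho.
- by rewrite divr_ge0 ?ltW.
Qed.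

Let F x := \int[mu]_(y in `]-oo, x]) rho y.
(** The tail, written as a complement so that the fundamental theorem with a variable upper endpoint
    yields its derivative. *)
Let S x := \int[mu]_(y in [set: R]) rho y - F x.

Let dS (x : R) : is_derive x 1 S (- rho x).
Proof.
have int' : mu.-integrable `]-oo, x + 1] (EFin \o rho).
  by apply: integrableS intrho.
have [| | |dF F'] := @continuous_FTC1 R rho -oo%O x (x + 1) _ int'.
- by rewrite ltrDl.
- by rewrite ltNyr.
- exact: crho.
have : is_derive x 1 F (rho x) by apply: (DeriveDef dF); rewrite -derive1E.
move=> H; rewrite -[- _]sub0r; exact: is_deriveB.
Qed.

Let SE x : (S x)%:E = (\int[mu]_(y in `[x, +oo[) (rho y)%:E)%E.
Proof.
have int' : mu.-integrable `]x, +oo[ (EFin \o rho) by apply: integrableS intrho.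
have -> : S x = \int[mu]_(y in `]x, +oo[) rho y.
  by rewrite /S -set_itvNyy Rintegral_itvB// set_itvNyy.
rewrite -integral_itv_obnd_cbnd; last exact: (measurable_int _ int').
by rewrite fineK// integrable_fin_num.
Qed.

Let S_ge0 x : 0 <= S x.
Proof.
by rewrite -lee_fin SE; apply: integral_ge0 => y _; rewrite lee_fin ltW.
Qed.

(** [S] is nonnegative at [x + 1] and, having derivative [- rho < 0], strictly larger at [x]. *)
Let S_gt0 x : 0 < S x.
Proof.
have cS : continuous S.
  by apply: derivable_continuous => y; have [] := dS y.
have xx1 : x < x + 1 by rewrite ltrDl.
have [y _ E] := @MVT _ S (fun y => - rho y) x (x + 1) xx1 (fun y _ => dS y)
  (continuous_subspaceT cS).
apply: le_lt_trans (S_ge0 (x + 1)) _; rewrite -subr_lt0 E.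
by rewrite addrAC subrr add0r mulr1 oppr_lt0.
Qed.

(** Hardy's inequality with [C = K / rho m], which dominates the ratio of tail to density by the
    previous bound. *)
Lemma half_line_poincare (K : R) g :
  (\int[mu]_(y in `[m, +oo[) (rho y)%:E <= K%:E)%E ->
  (forall x, derivable g x 1) ->
  (\int[mu]_(x in `[m, +oo[) ((g x - g m) ^+ 2 * rho x)%:E <=
   (4 * (K / rho m) ^+ 2)%:E *
     \int[mu]_(x in `[m, +oo[) (derive1 g x ^+ 2 * rho x)%:E)%E.
Proof.
move=> mK dg; apply: (@hardy_half_line _ rho S) => // x mx.
rewrite -lee_fin SE; apply: (le_trans (tail_le_density mx)).
have -> : K / rho m * rho x = rho x / rho m * K by ring.
by rewrite [leRHS]EFinM lee_pmul2l// lte_fin divr_gt0.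
Qed.

End right.

(** * The left half-line, by reflection *)

Section left.
Variables (rho : R -> R) (m : R).
Hypotheses (crho : continuous rho) (rho0 : forall x, 0 < rho x)
  (lc : log_concave_density rho)
  (intrho : mu.-integrable [set: R] (EFin \o rho)).

Let crhoN : continuous (fun x => rho (- x)).
Proof.
move=> x; apply: (@cvg_comp _ _ _ -%R rho); last exact: crho.
exact: opp_continuous.
Qed.

Let integral_leftE x (f : R -> R) :
  measurable_fun [set: R] f -> (forall x, 0 <= f x) ->
  (\int[mu]_(y in `]-oo, x]) (f y)%:E = \int[mu]_(y in `[(- x)%R, +oo[) (f (- y)%R)%:E)%E.
Proof.
move=> mf f0; rewrite (@ge0_integral_opp R _ (fun y => (f y)%:E))//.
- rewrite (_ : -%R @^-1` _ = `[(- x), +oo[%classic)//.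
  by apply/seteqP; split=> y /=; rewrite !in_itv/= andbT lerNl.
- exact/measurable_EFinP.
Qed.

Let mrho : measurable_fun [set: R] rho.
Proof. exact: continuous_measurable_fun. Qed.

Let intrhoN : mu.-integrable [set: R] (EFin \o (fun x => rho (- x))).
Proof.
apply/integrableP; split.
  by apply/measurable_EFinP; exact: continuous_measurable_fun.
have [_] := integrableP _ _ _ intrho.
rewrite (@ge0_integral_opp R _ (fun x => `|(rho x)%:E|)%E)//.
by apply: measurableT_comp => //; exact/measurable_EFinP.
Qed.

Lemma left_tail_le_density (x : R) : x <= m ->
  (\int[mu]_(y in `]-oo, x]) (rho y)%:E <=
   (rho x / rho m)%:E * \int[mu]_(y in `]-oo, m]) (rho y)%:E)%E.
Proof.
move=> xm; have rho_ge0 y : 0 <= rho y by exact: ltW.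
rewrite !integral_leftE//.
have := @tail_le_density _ (- m) crhoN (fun=> rho0 _) (log_concave_density_opp lc) (- x).
by rewrite !opprK; apply; rewrite lerN2.
Qed.

Lemma left_half_line_poincare (K : R) g :
  (\int[mu]_(y in `]-oo, m]) (rho y)%:E <= K%:E)%E ->
  (forall x, derivable g x 1) ->
  (\int[mu]_(x in `]-oo, m]) ((g x - g m) ^+ 2 * rho x)%:E <=
   (4 * (K / rho m) ^+ 2)%:E *
     \int[mu]_(x in `]-oo, m]) (derive1 g x ^+ 2 * rho x)%:E)%E.
Proof.
move=> mK dg; have rho_ge0 y : 0 <= rho y by exact: ltW.
move: mK; rewrite !integral_leftE//; last 4 first.
- by apply: measurable_funM => //; apply: measurable_funX; exact: measurable_derive1.
- by move=> y; rewrite mulr_ge0// sqr_ge0.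
- apply: measurable_funM => //; apply: measurable_funX.
  apply: measurable_funB => //; apply: continuous_measurable_fun.
  exact: derivable_continuous.
- by move=> y; rewrite mulr_ge0// sqr_ge0.
move=> mK.
have dgN (x : R) : is_derive x 1 (fun x => g (- x)) (- derive1 g (- x)).
  have dgx : is_derive (- x) 1 g (derive1 g (- x)).
    by rewrite derive1E; exact: derivableP.
  apply: (is_derive_eq (is_derive1_comp dgx (is_deriveN (is_derive_id x 1)))).
  by rewrite mulrN1.
have := @half_line_poincare _ (- m) crhoN (fun=> rho0 _) (log_concave_density_opp lc) intrhoN
  K (fun x => g (- x)) mK.
rewrite !opprK.
have E x : derive1 (fun x => g (- x)) x = - derive1 g (- x).
  by rewrite derive1E; have [_ ->] := dgN x.
move=> H; apply: le_trans (H _) _ => [x|]; first by have [] := dgN x.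
by under eq_integral do rewrite E sqrrN.
Qed.

End left.

End log_concave_density.

(** * Log-concave probability measures and their median *)

Section log_concave_measure.
Context {R : realType}.
Notation leb := (@lebesgue_measure R).
Variables (mu : probability R R) (c : R) (v : R -> R) (m : R).
Hypotheses (lcmu : log_concave mu c v) (medm : is_median mu m).
Let rho := boltzmann_density c v.

Let c0 : 0 < c. Proof. by case: lcmu => -[]. Qed.

Let rho0 x : 0 < rho x. Proof. by rewrite mulr_gt0 ?expR_gt0 ?c0. Qed.

Let crho : continuous rho.
Proof.
case: lcmu => -[_ cv _] _ x; apply: cvgM; first exact: cvg_cst.
apply: (@cvg_comp _ _ _ (fun x => - v x) expR); last exact: continuous_expR.
by apply: cvgN; exact: cv.
Qed.

Let lcrho : log_concave_density rho.
Proof. by case: lcmu => -[? _ _] ?; exact: convex_log_concave_density. Qed.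

Let muE A : measurable A -> mu A = (\int[leb]_(x in A) (rho x)%:E)%E.
Proof. by case: lcmu => -[_ _ E] _; exact: E. Qed.

Let intrho : leb.-integrable [set: R] (EFin \o rho).
Proof.
apply/integrableP; split.
  by apply/measurable_EFinP; exact: continuous_measurable_fun.
have absE x : (`|(EFin \o rho) x| = (rho x)%:E)%E.
  by rewrite /= ger0_norm// ltW.
under eq_integral do rewrite absE.
by rewrite -(muE measurableT) probability_setT ltry.
Qed.

Let tailE x : mu `]x, +oo[%classic = (1 - fine (mu `]-oo, x]%classic))%:E.
Proof.
have : (mu `]-oo, x]%classic + mu `]x, +oo[%classic = 1)%E.
  rewrite -measureU//; last first.
    by apply/seteqP; split => y //= []; rewrite !in_itv/= andbT leNgt => /negP.
  rewrite (_ : _ `|` _ = setT); first exact: probability_setT.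
  apply/seteqP; split=> y //= _; rewrite !in_itv/= andbT.
  by have [yx|xy] := leP y x; [left|right].
have /fineK <- : mu `]-oo, x]%classic \is a fin_num by rewrite fin_num_measure.
have /fineK <- : mu `]x, +oo[%classic \is a fin_num by rewrite fin_num_measure.
by rewrite -EFinD => -[E]; congr EFin; rewrite -E /=; ring.
Qed.

Let half_l : mu `]-oo, m]%classic = (2^-1)%:E.
Proof.
have := tailE m; rewrite -medm.
have /fineK <- : mu `]-oo, m]%classic \is a fin_num by rewrite fin_num_measure.
by move=> [/= E]; congr EFin; lra.
Qed.

Let half_r : mu `]m, +oo[%classic = (2^-1)%:E. Proof. by rewrite -medm. Qed.

(** The two closed half-lines share only [m], a Lebesgue null point. *)
Lemma integral_log_concave (f : R -> R) : measurable_fun [set: R] f ->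
  (forall x, 0 <= f x) ->
  (\int[mu]_x (f x)%:E = \int[leb]_(x in `]-oo, m]) (f x * rho x)%:E +
     \int[leb]_(x in `[m, +oo[) (f x * rho x)%:E)%E.
Proof.
move=> mf f0.
have mrho : measurable_fun [set: R] rho by exact: continuous_measurable_fun.
have mfr D : measurable_fun D (fun x => (f x * rho x)%:E).
  by apply: measurable_funTS; apply/measurable_EFinP; exact: measurable_funM.
have mEf : measurable_fun [set: R] (EFin \o f) by exact/measurable_EFinP.
rewrite (integral_density mrho (fun x => ltW (rho0 x)) muE mEf); last first.
  by move=> x; rewrite lee_fin.
rewrite -set_itvNyy (@itv_bndbnd_setU _ _ -oo%O (BRight m) +oo%O)//.
rewrite ge0_integral_setU//=.
- by rewrite -[in RHS]integral_itv_obnd_cbnd//; exact: mfr.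
- exact: mfr.
- by move=> x _; apply: mule_ge0; rewrite lee_fin// ltW.
- apply: lt_disjoint => p q /=; rewrite !in_itv/= andbT; exact: le_lt_trans.
Qed.

Theorem log_concave_poincare (g : R -> R) : (forall x, derivable g x 1) ->
  (\int[mu]_x ((g x - g m) ^+ 2)%:E <=
   ((expR (v m) / c) ^+ 2)%:E * \int[mu]_x (derive1 g x ^+ 2)%:E)%E.
Proof.
move=> dg.
have mg : measurable_fun [set: R] g.
  by apply: continuous_measurable_fun; exact: derivable_continuous.
have mg1 : measurable_fun [set: R] (fun x => (g x - g m) ^+ 2).
  by apply: measurable_funX; exact: measurable_funB.
have mg2 : measurable_fun [set: R] (fun x => derive1 g x ^+ 2 : R).
  by apply: measurable_funX; exact: measurable_derive1.
rewrite (integral_log_concave mg1) => [|x]; last exact: sqr_ge0.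
rewrite (integral_log_concave mg2) => [|x]; last exact: sqr_ge0.
(* Here [2^-1] is the mass on either side of the median, so both half-lines have the same constant
   and their inequalities add. *)
have -> : (expR (v m) / c) ^+ 2 = 4 * (2^-1 / rho m) ^+ 2.
  rewrite /rho /boltzmann_density expRN; field.
  by rewrite !gt_eqF ?expR_gt0 ?c0.
rewrite ge0_muleDr; last 2 first.
- by apply: integral_ge0 => x _; rewrite lee_fin mulr_ge0 ?sqr_ge0 ?ltW.
- by apply: integral_ge0 => x _; rewrite lee_fin mulr_ge0 ?sqr_ge0 ?ltW.
apply: leeD.
- by apply: left_half_line_poincare => //; rewrite -muE// half_l.
- apply: half_line_poincare => //; rewrite -integral_itv_obnd_cbnd.
    by rewrite -muE// half_r.
  by apply: measurable_funTS; apply/measurable_EFinP; exact: continuous_measurable_fun.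
Qed.

(** The supremum is attained at the median: to its left the distribution function is at most
    [rho x / (2 * rho m)], and to its right its complement obeys the same bound. *)
Theorem log_concave_cheeger : cheeger mu rho = (expR (v m) / c / 2)%:E.
Proof.
have rE : expR (v m) / c / 2 = 2^-1 / rho m.
  rewrite /rho /boltzmann_density expRN; field.
  by rewrite !gt_eqF ?expR_gt0 ?c0.
rewrite rE /cheeger.
apply/eqP; rewrite eq_le; apply/andP; split.
  apply: ge_ereal_sup => _ [x _ <-]; rewrite lee_fin ler_pdivrMr//.
  have [xm|/ltW mx] := leP x m.
    rewrite ge_min; apply/orP; left; rewrite -lee_fin fineK ?fin_num_measure//.
    rewrite muE//; apply: (le_trans (left_tail_le_density crho rho0 lcrho xm)).
    by rewrite -muE// half_l -EFinM lee_fin mulrC mulrA mulrAC.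
  rewrite ge_min; apply/orP; right; rewrite -lee_fin -tailE muE//.
  have mrho D : measurable_fun D (EFin \o rho).
    by apply: measurable_funTS; apply/measurable_EFinP; exact: continuous_measurable_fun.
  rewrite integral_itv_obnd_cbnd//; apply: (le_trans (tail_le_density crho rho0 lcrho mx)).
  rewrite -integral_itv_obnd_cbnd// -muE// half_r -EFinM lee_fin.
  by rewrite mulrC mulrA mulrAC.
apply: ereal_sup_ubound; exists m => //.
rewrite half_l/=; congr (_ / _)%:E; rewrite minEle.
by case: ifPn => // _; lra.
Qed.

End log_concave_measure.

(** * Square integrable random variables *)

Section second_moment.
Context {R : realType} {d} {T : measurableType d} (P : probability T R).
Implicit Types f g : T -> R.

Definition in_L1 f := P.-integrable [set: T] (EFin \o f).

(** Measurability of [f] is recorded because integrability of its square does not imply it. *)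
Definition in_L2 f := measurable_fun [set: T] f /\ in_L1 (fun t => f t ^+ 2).

Definition scalar_product f g : R := \int[P]_t (f t * g t).
Local Notation "<< f , g >>" := (scalar_product f g).

Lemma in_L1_le f g : measurable_fun [set: T] f -> in_L1 g ->
  (forall t, `|f t| <= g t) -> in_L1 f.
Proof.
move=> mf Lg fg; apply: (le_integrable measurableT _ _ Lg).
  exact/measurable_EFinP.
by move=> t _ /=; rewrite lee_fin (le_trans (fg t))// ler_norm.
Qed.

Lemma in_L1_ext f g : f =1 g -> in_L1 f -> in_L1 g.
Proof. by move=> /funext ->. Qed.

Lemma in_L1D f g : in_L1 f -> in_L1 g -> in_L1 (fun t => f t + g t).
Proof. by move=> Lf Lg; exact: (integrableD measurableT Lf Lg). Qed.

Lemma in_L1B f g : in_L1 f -> in_L1 g -> in_L1 (fun t => f t - g t).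
Proof. by move=> Lf Lg; exact: (integrableB measurableT Lf Lg). Qed.

Lemma in_L1_measurable f : in_L1 f -> measurable_fun [set: T] f.
Proof. by move=> /measurable_int/measurable_EFinP. Qed.

Lemma in_L1_cst (k : R) : in_L1 (cst k).
Proof. exact: finite_measure_integrable_cst. Qed.

Lemma in_L1_indic (A : set T) : measurable A -> in_L1 (\1_A : T -> R).
Proof.
move=> mA; apply: (in_L1_le _ (in_L1_cst 1)) => //= t.
by rewrite indicE; case: (_ \in _); rewrite ?normr1 ?normr0.
Qed.

Lemma in_L1M f g : in_L2 f -> in_L2 g -> in_L1 (fun t => f t * g t).
Proof.
move=> [mf Lf] [mg Lg]; apply: (in_L1_le _ (in_L1D Lf Lg)).
  exact: measurable_funM.
move=> t; rewrite normrM -(real_normK (num_real (f t))) -(real_normK (num_real (g t))).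
by have := sqr_ge0 (`|f t| - `|g t|); have := mulr_ge0 (normr_ge0 (f t)) (normr_ge0 (g t)); lra.
Qed.

Lemma in_L2D f g : in_L2 f -> in_L2 g -> in_L2 (fun t => f t + g t).
Proof.
move=> Lf Lg; have [mf L2f] := Lf; have [mg L2g] := Lg.
split; first exact: measurable_funD.
have Lfg := in_L1M Lf Lg.
by apply: (in_L1_ext _ (in_L1D (in_L1D L2f (in_L1D Lfg Lfg)) L2g)) => t; ring.
Qed.

Lemma in_L2N f : in_L2 f -> in_L2 (fun t => - f t).
Proof.
move=> [mf Lf]; split; first exact: measurableT_comp.
by apply: (in_L1_ext _ Lf) => t; rewrite sqrrN.
Qed.

Lemma in_L2B f g : in_L2 f -> in_L2 g -> in_L2 (fun t => f t - g t).
Proof. by move=> Lf Lg; apply: in_L2D => //; exact: in_L2N. Qed.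

Lemma in_L20 : in_L2 (cst 0).
Proof.
split; first exact: measurable_cst.
by apply: (in_L1_ext _ (in_L1_cst 0)) => t; rewrite expr0n.
Qed.

Lemma in_L2_sum (I : Type) (s : seq I) (p : pred I) (F : I -> T -> R) :
  (forall i, p i -> in_L2 (F i)) -> in_L2 (fun t => \sum_(i <- s | p i) F i t).
Proof.
move=> LF; elim: s => [|i s IH].
  by under eq_fun do rewrite big_nil; exact: in_L20.
under eq_fun do rewrite big_cons.
by case: (boolP (p i)) => // pi; apply: in_L2D => //; exact: LF.
Qed.

Lemma in_L2_L1 f : in_L2 f -> in_L1 f.
Proof.
move=> [mf Lf]; apply: (in_L1_le mf (in_L1D (in_L1_cst 1) Lf)) => t /=.
rewrite -(real_normK (num_real (f t))).
by have := sqr_ge0 (`|f t| - 1); have := normr_ge0 (f t); lra.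
Qed.

Lemma scalar_productC f g : << f, g >> = << g, f >>.
Proof. by apply: eq_Rintegral => t _; rewrite mulrC. Qed.

Lemma scalar_product0 g : << cst 0, g >> = 0.
Proof.
rewrite /scalar_product; under eq_Rintegral do rewrite mul0r.
by rewrite Rintegral_cst// mul0r.
Qed.

Lemma scalar_productDl f f' g : in_L2 f -> in_L2 f' -> in_L2 g ->
  << fun t => f t + f' t, g >> = << f, g >> + << f', g >>.
Proof.
move=> Lf Lf' Lg; rewrite /scalar_product -RintegralD//; try exact: in_L1M.
by apply: eq_Rintegral => t _; rewrite mulrDl.
Qed.

Lemma scalar_productBl f f' g : in_L2 f -> in_L2 f' -> in_L2 g ->
  << fun t => f t - f' t, g >> = << f, g >> - << f', g >>.
Proof.
move=> Lf Lf' Lg; rewrite /scalar_product -RintegralB//; try exact: in_L1M.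
by apply: eq_Rintegral => t _; rewrite mulrBl.
Qed.

Lemma scalar_productBr f g g' : in_L2 f -> in_L2 g -> in_L2 g' ->
  << f, fun t => g t - g' t >> = << f, g >> - << f, g' >>.
Proof.
by move=> Lf Lg Lg'; rewrite scalar_productC scalar_productBl// ![<< _, f >>]scalar_productC.
Qed.

Lemma scalar_product_suml (I : Type) (s : seq I) (p : pred I) (F : I -> T -> R) g :
  (forall i, p i -> in_L2 (F i)) -> in_L2 g ->
  << fun t => \sum_(i <- s | p i) F i t, g >> = \sum_(i <- s | p i) << F i, g >>.
Proof.
move=> LF Lg; elim: s => [|i s IH].
  by rewrite big_nil -[RHS](scalar_product0 g); under eq_fun do rewrite big_nil.
rewrite big_cons; under eq_fun do rewrite big_cons.
case: (boolP (p i)) => // pi; rewrite scalar_productDl ?IH//; first exact: LF.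
exact: in_L2_sum.
Qed.

Lemma scalar_product_sumr (I : Type) (s : seq I) (p : pred I) (F : I -> T -> R) g :
  (forall i, p i -> in_L2 (F i)) -> in_L2 g ->
  << g, fun t => \sum_(i <- s | p i) F i t >> = \sum_(i <- s | p i) << g, F i >>.
Proof.
move=> LF Lg; rewrite scalar_productC scalar_product_suml//.
by apply: eq_bigr => i _; rewrite scalar_productC.
Qed.

Lemma scalar_product_ge0 f : 0 <= << f, f >>.
Proof. by apply: Rintegral_ge0 => t _; rewrite -expr2 sqr_ge0. Qed.

Lemma expectation_sqr f : in_L2 f -> ('E_P[fun t => (f t ^+ 2)%R] = (scalar_product f f)%:E)%E.
Proof.
move=> [mf Lf]; rewrite unlock /scalar_product /Rintegral fineK//.
exact: integrable_fin_num.
Qed.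

Lemma in_L2P f : measurable_fun [set: T] f ->
  ('E_P[fun t => (f t ^+ 2)%R] < +oo)%E -> in_L2 f.
Proof.
move=> mf; rewrite unlock => Ef; split=> //; apply/integrableP; split.
  by apply/measurable_EFinP; exact: measurable_funX.
by under eq_integral do rewrite /= ger0_norm ?sqr_ge0//.
Qed.

End second_moment.

(** * Orthogonality to functions measurable for a smaller sigma-algebra *)

Section orthogonality.
Context {R : realType} {d} {T : measurableType d} (P : probability T R).

(* pi-lambda theorem for the signed measure of density [D] *)
Lemma integral0_pi_lambda (G : set_system T) (D : T -> R) :
  setI_closed G -> G `<=` measurable -> in_L1 P D ->
  (\int[P]_t (D t)%:E = 0)%E ->
  (forall A, G A -> (\int[P]_(t in A) (D t)%:E = 0)%E) ->
  forall A, <<s G >> A -> (\int[P]_(t in A) (D t)%:E = 0)%E.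
Proof.
move=> GI Gm LD D0 GD0 A sA.
have mED B : measurable_fun B (EFin \o D).
  by apply: measurable_funTS; exact: measurable_int LD.
suff : <<s G >> `<=` [set B | measurable B /\ (\int[P]_(t in B) (D t)%:E = 0)%E].
  by move=> /(_ _ sA)[].
apply: lambda_system_subset => //; last first.
  by move=> B GB; split; [exact: Gm|exact: GD0].
apply/dynkin_lambda_system; split.
- by split.
- move=> B [mB B0]; split; first exact: measurableC.
  have := D0; rewrite -(setUv B) integral_setU//; last first.
    by apply/disj_setPS; rewrite setICr.
    exact: measurableC.
  by rewrite B0 add0e.
move=> F tF HF; have mF k : measurable (F k) by have [] := HF k.
split; first exact: bigcup_measurable.
rewrite integral_bigcup//; last first.
  by apply: integrableS LD => //; exact: bigcup_measurable.
by rewrite eseries0// => k _ _; have [] := HF k.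
Qed.

(** Write [D] as the difference of the nonnegative densities |D| + D and |D|. They have equal
    integrals over each set of the sigma-algebra, hence integrate each nonnegative function
    measurable for it alike; testing with |W| and with |W| + W and subtracting reaches [W]. *)
Lemma integral_mul_eq0 (G : set_system T) (D W : T -> R) :
  G `<=` measurable -> in_L1 P D ->
  (forall A, <<s G >> A -> (\int[P]_(t in A) (D t)%:E = 0)%E) ->
  (forall B, measurable B -> <<s G >> (W @^-1` B)) ->
  in_L1 P (fun t => D t * W t) ->
  \int[P]_t (D t * W t) = 0.
Proof.
move=> Gm LD D0 mW LDW.
have sGm : <<s G >> `<=` measurable.
  by apply: smallest_sub => //; exact: sigma_algebra_measurable.
(* [T] with the smaller sigma-algebra: measurability of [W] for it becomes ordinary measurability on
   [TG]. *)
pose TG := g_sigma_algebraType G.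
have mid : measurable_fun [set: T] (id : T -> TG).
  by move=> _ A mA; rewrite setTI; exact: sGm.
have mWG : measurable_fun [set: TG] (W : TG -> R).
  by move=> _ B mB; rewrite setTI; exact: mW.
have mWT : measurable_fun [set: T] W.
  by move=> _ B mB; rewrite setTI; apply: sGm; exact: mW.
have mD := in_L1_measurable LD.
have LaD : in_L1 P (fun t => `|D t|) by exact: integrable_norm.
have key (f : TG -> R) : measurable_fun [set: TG] f -> (forall t, 0 <= f t) ->
    (\int[P]_t (f t * (`|D t| + D t))%:E = \int[P]_t (f t * `|D t|)%:E)%E.
  move=> mf f0.
  apply: (@eq_integral_density _ _ _ _ _ TG _ P P id id _ _ (EFin \o f)) => //.
  - apply: measurable_funD => //; exact: measurableT_comp.
  - exact: measurableT_comp.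
  - by move=> t; have := ler_norm (- D t); rewrite normrN; lra.
  - move=> A mA; rewrite preimage_id.
    under eq_integral do rewrite EFinD.
    rewrite integralD//; last 3 first.
    + exact: sGm.
    + by apply: integrableS LaD => //; exact: sGm.
    + by apply: integrableS LD => //; exact: sGm.
    by rewrite D0// adde0.
  - exact/measurable_EFinP.
have L4 (f : T -> R) : measurable_fun [set: T] f ->
    (forall t, `|f t| = `|D t * W t|) -> in_L1 P f.
  move=> mf fE; apply: (in_L1_le mf (integrable_norm LDW)) => t.
  by rewrite fE.
have maW : measurable_fun [set: T] (fun t => `|W t|) by exact: measurableT_comp.
have maD : measurable_fun [set: T] (fun t => `|D t|) by exact: measurableT_comp.
have La : in_L1 P (fun t => `|W t| * `|D t|).
  by apply: L4 => [|t]; [exact: measurable_funM|rewrite normrM !normr_id normrM mulrC].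
have Lb : in_L1 P (fun t => W t * `|D t|).
  by apply: L4 => [|t]; [exact: measurable_funM|rewrite !normrM !normr_id mulrC].
have Lc : in_L1 P (fun t => `|W t| * D t).
  by apply: L4 => [|t]; [exact: measurable_funM|rewrite !normrM !normr_id mulrC].
have Lw : in_L1 P (fun t => W t * D t).
  by apply: L4 => [|t]; [exact: measurable_funM|rewrite mulrC].
have e1 : \int[P]_t (`|W t| * D t) = 0.
  have maWG : measurable_fun [set: TG] (fun t => `|W t|).
    by apply: measurableT_comp => //; exact: mWG.
  have /(congr1 fine) H := key _ maWG (fun=> normr_ge0 _).
  have : \int[P]_t (`|W t| * `|D t| + `|W t| * D t) = \int[P]_t (`|W t| * `|D t|).
    by rewrite -[RHS]H; apply: eq_Rintegral => t _; rewrite mulrDr.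
  by rewrite RintegralD//; lra.
have maWG : measurable_fun [set: TG] (fun t => `|W t| + W t).
  by apply: measurable_funD; [apply: measurableT_comp => //; exact: mWG|exact: mWG].
have W0 t : 0 <= `|W t| + W t by have := ler_norm (- W t); rewrite normrN; lra.
have /(congr1 fine) H := key _ maWG W0.
have L2a := in_L1D La Lb; have L2b := in_L1D Lc Lw.
have : \int[P]_t ((`|W t| * `|D t| + W t * `|D t|) + (`|W t| * D t + W t * D t)) =
    \int[P]_t (`|W t| * `|D t| + W t * `|D t|).
  transitivity (\int[P]_t ((`|W t| + W t) * `|D t|)); last first.
    by apply: eq_Rintegral => t _; rewrite mulrDl.
  by rewrite -[RHS]H; apply: eq_Rintegral => t _; ring.
rewrite RintegralD// [X in _ + X = _]RintegralD// e1 add0r.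
rewrite (_ : \int[P]_t (D t * W t) = \int[P]_t (W t * D t)); first lra.
by apply: eq_Rintegral => t _; rewrite mulrC.
Qed.

End orthogonality.

(** * Independent coordinates *)

Section independence.
Context {R : realType} {dT : measure_display} {T : measurableType dT}.
Variables (P : probability T R) (d : nat) (X : 'I_d -> {RV P >-> R}).
Implicit Types (u w : {set 'I_d}) (A : 'I_d -> set R).

Definition cylinder u A : set T := \bigcap_(i in [set i | i \in u]) (X i @^-1` A i).

Definition cylinders u : set_system T :=
  [set B | exists2 A, (forall i, measurable (A i)) & B = cylinder u A].

Lemma preimage_sigma_sub u i (B : set R) : i \in u -> measurable B ->
  sigma_sub X u (X i @^-1` B).
Proof.
move=> iu mB; apply: sub_sigma_algebra; exists i => //.
by exists B => //; rewrite setTI.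
Qed.

Lemma cylinder_sigma_sub u A : (forall i, measurable (A i)) ->
  sigma_sub X u (cylinder u A).
Proof.
move=> mA.
have : @measurable _ (g_sigma_algebraType (\bigcup_(i in [set i | i \in u])
        preimage_set_system [set: T] (X i) (@measurable _ R))) (cylinder u A).
  apply: fin_bigcap_measurable => [|i /= iu]; first exact: finite_finset.
  exact: preimage_sigma_sub.
by [].
Qed.

(** The defining generators are not stable under intersection in general; cylinders are, as
    pi-lambda arguments require. *)
Lemma sigma_sub_cylinders u : sigma_sub X u = <<s cylinders u >>.
Proof.
apply/seteqP; split.
  apply: smallest_sub; first exact: smallest_sigma_algebra.
  move=> _ [i /= iu [B mB <-]]; apply: sub_sigma_algebra.
  (* A single preimage is a cylinder whose other factors are the whole line. *)
  exists (fun k => if k == i then B else setT); first by move=> k; case: ifP.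
  rewrite setTI /cylinder; apply/seteqP; split=> t /=.
    by move=> Bt k _ /=; case: eqP => // ->.
  by move=> /(_ i iu) /=; rewrite eqxx.
apply: smallest_sub; first exact: smallest_sigma_algebra.
by move=> _ [A mA ->]; exact: cylinder_sigma_sub.
Qed.

Lemma sigma_sub_measurable u : sigma_sub X u `<=` measurable.
Proof.
apply: smallest_sub; first exact: sigma_algebra_measurable.
move=> _ [i _ [B mB <-]]; exact: measurable_funP.
Qed.

Lemma cylinder_measurable u A : (forall i, measurable (A i)) ->
  measurable (cylinder u A).
Proof. by move=> mA; apply: (@sigma_sub_measurable u); exact: cylinder_sigma_sub. Qed.

Lemma sigma_subS u w : u \subset w -> sigma_sub X u `<=` sigma_sub X w.
Proof.
move=> uw; apply: smallest_sub; first exact: smallest_sigma_algebra.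
move=> _ [i /= iu [B mB <-]]; rewrite setTI; apply: preimage_sigma_sub => //.
exact: (fintype.subsetP uw).
Qed.

Lemma cylinderT u : cylinder u (fun=> setT) = setT.
Proof. by apply/seteqP; split=> t //= _ i. Qed.

Lemma setI_closed_cylinders u : setI_closed (cylinders u).
Proof.
move=> _ _ [A mA ->] [B mB ->]; exists (fun i => A i `&` B i).
  by move=> i; exact: measurableI.
apply/seteqP; split=> t /=; first by move=> [h1 h2] i iu; split; [exact: h1|exact: h2].
by move=> h; split=> i iu; have [] := h i iu.
Qed.

Lemma cylinderI u w A : cylinder (u :|: w) A = cylinder u A `&` cylinder w A.
Proof.
apply/seteqP; split=> t /=.
  by move=> h; split=> i /= iu; apply: h; rewrite /= inE iu ?orbT.
by move=> [h1 h2] i /=; rewrite inE => /orP[]; [exact: h1|exact: h2].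
Qed.

Hypothesis indep : independent X.

(** [A] on [u] and [B] elsewhere glue into one family, which turns the intersection into a cylinder
    over the union of [u] and [w]. *)
Lemma cylinder_indep u w A B : (forall i, i \in u -> i \notin w) ->
  (forall i, measurable (A i)) -> (forall i, measurable (B i)) ->
  P (cylinder u A `&` cylinder w B) = (P (cylinder u A) * P (cylinder w B))%E.
Proof.
move=> uw mA mB.
pose C i := if i \in u then A i else B i.
have mC i : measurable (C i) by rewrite /C; case: ifP.
have wu i : i \in w -> i \in u = false.
  by move=> iw; apply/negbTE/negP => /uw; rewrite iw.
have CA : cylinder u A = cylinder u C.
  by apply/seteqP; split=> t /= h i /= iu; have := h i iu; rewrite /C iu.
have CB : cylinder w B = cylinder w C.
  by apply/seteqP; split=> t /= h i /= iw; have := h i iw; rewrite /C (wu i iw).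
rewrite CA CB -cylinderI /cylinder !indep//.
rewrite -bigU//=; [by apply: eq_bigl => i; rewrite !inE|by apply/pred0P => i /=; apply/negbTE/negP => /andP[/uw/negP]].
Qed.

(** Independence phrased as the vanishing of a signed measure, so that the pi-lambda lemma carries
    it from cylinders over [u] to all events of [sigma_sub X u]. *)
Lemma integral_centered_cylinder u w A B : (forall i, i \in u -> i \notin w) ->
  (forall i, measurable (A i)) -> sigma_sub X u B ->
  (\int[P]_(t in B) (\1_(cylinder w A) t - fine (P (cylinder w A)))%:E = 0)%E.
Proof.
move=> uw mA; rewrite sigma_sub_cylinders.
have mc := cylinder_measurable w mA.
set p := fine _.
have pE : P (cylinder w A) = p%:E by rewrite fineK// fin_num_measure.
have L1 := in_L1_indic P mc.
have key C : (forall i, measurable (C i)) ->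
    (\int[P]_(t in cylinder u C) (\1_(cylinder w A) t - p)%:E = 0)%E.
  move=> mC; have mu_ := cylinder_measurable u mC.
  have Lc := in_L1_cst P p.
  under eq_integral do rewrite EFinB.
  rewrite integralB//; last 2 first.
  - exact: (integrableS measurableT mu_ _ L1).
  - exact: (integrableS measurableT mu_ _ Lc).
  rewrite integral_indic// (integral_cst P mu_ p%:E).
  rewrite [X in (X - _)%E](_ : _ = P (cylinder u C) * P (cylinder w A))%E; last first.
    by rewrite setIC; exact: cylinder_indep.
  rewrite pE muleC subee//.
  have /fineK <- : P (cylinder u C) \is a fin_num by rewrite fin_num_measure.
  by rewrite -EFinM.
move=> sB; apply: (integral0_pi_lambda _ _ _ _ _ sB).
- exact: setI_closed_cylinders.
- by move=> _ [C mC ->]; exact: cylinder_measurable.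
- exact: (in_L1B L1 (in_L1_cst P p)).
- by have := key (fun=> setT); rewrite cylinderT; apply.
- by move=> _ [C mC ->]; exact: key.
Qed.

Lemma sigma_sub_indep u w A B : (forall i, i \in u -> i \notin w) ->
  (forall i, measurable (A i)) -> sigma_sub X u B ->
  P (cylinder w A `&` B) = (P (cylinder w A) * P B)%E.
Proof.
move=> uw mA sB; have mc := cylinder_measurable w mA.
have mB := sigma_sub_measurable sB.
have := integral_centered_cylinder uw mA sB.
have L1 := in_L1_indic P mc.
under eq_integral do rewrite EFinB.
rewrite integralB//; last 2 first.
- exact: (integrableS measurableT mB _ L1).
- exact: (integrableS measurableT mB _ (in_L1_cst P _)).
rewrite integral_indic// (integral_cst P mB (fine (P (cylinder w A)))%:E).
rewrite fineK ?fin_num_measure// => /eqP; rewrite sube_eq ?add0e => [/eqP//| |].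
- by rewrite fin_num_measure//; exact: measurableI.
- by rewrite fin_num_adde_defl// fin_numM// fin_num_measure.
Qed.

Lemma sigma_sub_funM u (Z : T -> R) B : sigma_sub X u B ->
  (forall C : set R, measurable C -> sigma_sub X u (Z @^-1` C)) ->
  forall C : set R, measurable C -> sigma_sub X u ((fun t => \1_B t * Z t) @^-1` C).
Proof.
move=> sB mZ C mC.
pose TG := g_sigma_algebraType (\bigcup_(i in [set i | i \in u])
        preimage_set_system [set: T] (X i) (@measurable _ R)).
have mZG : measurable_fun [set: TG] (Z : TG -> R).
  by move=> _ D mD; rewrite setTI; exact: mZ.
have mW : measurable_fun [set: TG] ((fun t => \1_B t * Z t) : TG -> R).
  by apply: measurable_funM => //; exact: measurable_indic.
by have := mW measurableT C mC; rewrite setTI.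
Qed.

Lemma sigma_sub_measurable_fun u (Z : T -> R) :
  (forall C : set R, measurable C -> sigma_sub X u (Z @^-1` C)) ->
  measurable_fun [set: T] Z.
Proof.
by move=> mZ _ C mC; rewrite setTI; apply: (@sigma_sub_measurable u); exact: mZ.
Qed.

Lemma integral_sigma_sub_mul_eq0 u (D W : T -> R) : in_L1 P D ->
  (forall B, sigma_sub X u B -> (\int[P]_(t in B) (D t)%:E = 0)%E) ->
  (forall C : set R, measurable C -> sigma_sub X u (W @^-1` C)) ->
  in_L1 P (fun t => D t * W t) ->
  \int[P]_t (D t * W t) = 0.
Proof.
move=> LD D0 mW LDW; apply: (@integral_mul_eq0 _ _ _ _ _ D W _ LD D0 mW LDW).
move=> _ [i _ [B mB <-]]; exact: measurable_funP.
Qed.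

(** The centered indicator of the cylinder is orthogonal to the function [\1_B * Z] of [X_u], so the
    probability of the cylinder factors out; over [B], [Z] integrates like [Y]. *)
Lemma cond_exp_cylinder u w A B (Y Z : T -> R) : (forall i, i \in u -> i \notin w) ->
  (forall i, measurable (A i)) -> sigma_sub X u B ->
  is_cond_exp P (sigma_sub X u) Y Z ->
  \int[P]_(t in B `&` cylinder w A) (Z t) =
    fine (P (cylinder w A)) * \int[P]_(t in B) (Y t).
Proof.
move=> uw mA sB [mZ LZ ZY].
have mB := sigma_sub_measurable sB.
have mc := cylinder_measurable w mA.
have mZT := sigma_sub_measurable_fun mZ.
set p := fine _.
have indic_le1 (C : set T) t : `|\1_C t : R| <= 1.
  by rewrite indicE; case: (_ \in _); rewrite ?normr1 ?normr0.
have L1c := in_L1_indic P mc.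
have LBZ : in_L1 P (fun t => \1_B t * Z t).
  apply: (in_L1_le _ (integrable_norm LZ)); first exact: measurable_funM.
  by move=> t; rewrite normrM /= ler_piMl// indic_le1.
have LcBZ : in_L1 P (fun t => \1_(cylinder w A) t * (\1_B t * Z t)).
  apply: (in_L1_le _ (integrable_norm LBZ)).
    by do 2?apply: measurable_funM.
  by move=> t; rewrite normrM /= ler_piMl// indic_le1.
have LpBZ : in_L1 P (fun t => p * (\1_B t * Z t)).
  by have := integrableZl measurableT p LBZ.
have := @integral_sigma_sub_mul_eq0 u (fun t => \1_(cylinder w A) t - p)
  (fun t => \1_B t * Z t) (in_L1B L1c (in_L1_cst P p)).
move=> /(_ (fun C sC => integral_centered_cylinder uw mA sC) (sigma_sub_funM sB mZ)).
have H t : (\1_(cylinder w A) t - p) * (\1_B t * Z t) =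
    \1_(cylinder w A) t * (\1_B t * Z t) - p * (\1_B t * Z t) by ring.
under eq_Rintegral do rewrite H; under eq_fun do rewrite H.
move=> /(_ (in_L1B LcBZ LpBZ)); rewrite RintegralB// RintegralZl//.
have -> : \int[P]_t (\1_(cylinder w A) t * (\1_B t * Z t)) =
    \int[P]_(t in B `&` cylinder w A) Z t.
  rewrite [RHS]Rintegral_mkcond; apply: eq_Rintegral => t _.
  rewrite patchE in_setI !indicE; case: (t \in B); case: (t \in cylinder w A);
    by rewrite ?(mul1r, mul0r, mulr0).
have -> : \int[P]_t (\1_B t * Z t) = \int[P]_(t in B) Y t.
  rewrite -[RHS](congr1 fine (ZY B sB)) -/(Rintegral _ _ _).
  rewrite [RHS]Rintegral_mkcond; apply: eq_Rintegral => t _.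
  by rewrite patchE !indicE; case: (t \in B); rewrite ?(mul1r, mul0r).
by move=> /eqP; rewrite subr_eq0 => /eqP.
Qed.

(* the conditional expectations [E[. | X_u]] commute *)
Lemma cond_exp_setI u w (Y Zu Zuw : T -> R) :
  is_cond_exp P (sigma_sub X u) Y Zu ->
  is_cond_exp P (sigma_sub X (u :&: w)) Y Zuw ->
  forall B, sigma_sub X w B -> (\int[P]_(t in B) (Zu t - Zuw t)%:E = 0)%E.
Proof.
move=> hu huw B; rewrite sigma_sub_cylinders.
have [mZu LZu _] := hu; have [mZuw LZuw _] := huw.
have LD : in_L1 P (fun t => Zu t - Zuw t) := in_L1B LZu LZuw.
have key A : (forall i, measurable (A i)) ->
    (\int[P]_(t in cylinder w A) (Zu t - Zuw t)%:E = 0)%E.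
  move=> mA; have mc := cylinder_measurable w mA.
  have LDc := integrableS measurableT mc (fun _ _ => I) LD.
  rewrite -[LHS]fineK ?integrable_fin_num//; congr EFin.
  rewrite -/(Rintegral _ _ _) RintegralB//; last 2 first.
  - exact: integrableS LZu.
  - exact: integrableS LZuw.
  (* The part of the cylinder over [u :&: w] is an event for both conditional expectations, the part
     over [w :\: u] is independent of both. Each integral thus becomes the same multiple of the same
     integral of [Y]. *)
  have wE : w = (u :&: w) :|: (w :\: u).
    by apply/setP => i; rewrite !inE; case: (i \in u); rewrite ?orbF.
  rewrite [in cylinder _ _]wE cylinderI.
  rewrite (@cond_exp_cylinder u (w :\: u) A _ Y)//; first last.
  - apply: (sigma_subS (finset.subsetIl u w)).
    exact: cylinder_sigma_sub.
  - by move=> i; rewrite !inE; case: (i \in u).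
  rewrite (@cond_exp_cylinder (u :&: w) (w :\: u) A _ Y)//; first last.
  - exact: cylinder_sigma_sub.
  - by move=> i; rewrite !inE; case: (i \in u).
  by rewrite subrr.
move=> sB; apply: (integral0_pi_lambda _ _ _ _ _ sB) => //.
- exact: setI_closed_cylinders.
- by move=> _ [C mC ->]; exact: cylinder_measurable.
- by have := key (fun=> setT); rewrite cylinderT; apply.
- by move=> _ [C mC ->]; exact: key.
Qed.

End independence.

(** * Hoeffding decomposition *)

Section hoeffding_decomposition.
Context {R : realType} {dT : measure_display} {T : measurableType dT}.
Variables (P : probability T R) (d : nat) (X : 'I_d -> {RV P >-> R}).
Implicit Types (u w : {set 'I_d}) (Y Z W : T -> R).
Local Notation "<< f , g >>" := (scalar_product P f g).

Lemma in_L2_bounded (f : T -> R) (k : R) : measurable_fun [set: T] f ->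
  (forall t, `|f t| <= k) -> in_L2 P f.
Proof.
move=> mf fk; split=> //; apply: (in_L1_le _ (in_L1_cst P (k ^+ 2))).
  exact: measurable_funX.
move=> t /=; rewrite normrX ler_sqr ?nnegrE// (le_trans _ (fk t))//.
Qed.

Lemma integral_cond_expB u Y Z B : in_L1 P Y ->
  is_cond_exp P (sigma_sub X u) Y Z -> sigma_sub X u B ->
  (\int[P]_(t in B) (Y t - Z t)%:E = 0)%E.
Proof.
move=> LY [mZ LZ ZY] sB; have mB := sigma_sub_measurable sB.
have LYB := integrableS measurableT mB (fun _ _ => I) LY.
under eq_integral do rewrite EFinB.
rewrite integralB//; last exact: integrableS LZ.
by rewrite ZY// subee// integrable_fin_num.
Qed.

(** [Z] is only known to be integrable, so it cannot be tested against itself. Its bounded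
    truncations [W n] satisfy [<< W n, W n >> = << Y, W n >>], whence their norm is at most that of
    [Y]; monotone convergence passes to [Z]. *)
Lemma cond_exp_in_L2 u Y Z : in_L2 P Y ->
  is_cond_exp P (sigma_sub X u) Y Z -> in_L2 P Z /\ << Z, Z >> <= << Y, Y >>.
Proof.
move=> LY hZ; have [mZ LZ ZY] := hZ.
have L1Y := in_L2_L1 LY.
have mZT := sigma_sub_measurable_fun mZ.
pose B n := Z @^-1` `[- n%:R, n%:R].
have sB n : sigma_sub X u (B n) by exact: mZ.
have mB n := sigma_sub_measurable (sB n).
have BE n t : (t \in B n) = (`|Z t| <= n%:R).
  by rewrite /B; apply/idP/idP; rewrite inE /= in_itv/= ler_norml.
pose W n t : R := \1_(B n) t * Z t.
have mW n : measurable_fun [set: T] (W n) by exact: measurable_funM.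
have LW n : in_L2 P (W n).
  apply: (@in_L2_bounded _ n%:R) => // t; rewrite /W indicE BE.
  by case: (boolP (`|Z t| <= n%:R)) => // Zn; rewrite ?mul1r ?mul0r ?normr0.
have WZ n t : Z t * W n t = W n t * W n t.
  by rewrite /W indicE; case: (t \in B n); rewrite ?mul1r ?mul0r ?mulr0.
have WY n : << W n, W n >> <= << Y, Y >>.
  have e t : (Y t - Z t) * W n t = Y t * W n t - W n t * W n t.
    by rewrite mulrBl WZ.
  have LYW := in_L1M LY (LW n); have LWW := in_L1M (LW n) (LW n).
  have := @integral_sigma_sub_mul_eq0 _ _ _ P d X u (fun t => Y t - Z t) (W n)
    (in_L1B L1Y LZ) (fun C => integral_cond_expB L1Y hZ) (sigma_sub_funM (sB n) mZ)
    (in_L1_ext (fun t => esym (e t)) (in_L1B LYW LWW)).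
  under eq_Rintegral do rewrite e.
  rewrite RintegralB// -!/(scalar_product _ _ _) => YW.
  have := scalar_product_ge0 P (fun t => Y t - W n t).
  have LYmW := in_L2B LY (LW n).
  rewrite scalar_productBl// !scalar_productBr// (scalar_productC P (W n) Y).
  lra.
have cvgW t : (W n t ^+ 2)%:E @[n --> \oo] --> (Z t ^+ 2)%:E.
  apply: cvg_near_cst; exists (Num.trunc `|Z t|).+1 => // n /= tn.
  congr EFin; rewrite /W indicE BE (_ : _ <= _) ?mul1r//.
  have /truncn_itv/andP[_ /ltW] := normr_ge0 (Z t).
  by move=> /le_trans; apply; rewrite ler_nat.
have mW2 n : measurable_fun [set: T] (fun t => (W n t ^+ 2)%:E).
  by apply/measurable_EFinP; exact: measurable_funX.
have Z2 : (\int[P]_t (Z t ^+ 2)%:E <= << Y, Y >>%:E)%E.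
  have -> : (\int[P]_t (Z t ^+ 2)%:E = \int[P]_t (limn (fun n => (W n t ^+ 2)%:E)))%E.
    by apply: eq_integral => t _; apply/esym/cvg_lim => //; exact: cvgW.
  have L := @cvg_monotone_convergence _ _ _ P _ measurableT
    (fun n t => (W n t ^+ 2)%:E) mW2.
  have {}L := L (fun n t _ => sqr_ge0 (W n t)).
  have {}L : (\int[P]_t (W n t ^+ 2)%:E)%E @[n --> \oo] -->
      (\int[P]_t (limn (fun n => (W n t ^+ 2)%:E)))%E.
    apply: L => t _ a b ab; rewrite lee_fin /W !indicE !BE.
    case: (boolP (`|Z t| <= a%:R)) => [Za|_]; last by rewrite mul0r expr0n sqr_ge0.
    by rewrite (le_trans Za) ?ler_nat.
  rewrite -(cvg_lim _ L)//; apply: lime_le; first by apply/cvg_ex; eexists; exact: L.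
  apply: nearW => n; have [_ LW2] := LW n.
  rewrite -[leLHS]fineK ?integrable_fin_num// lee_fin.
  by apply: le_trans (WY n).
have LZ2 : in_L2 P Z.
  by apply: in_L2P => //; rewrite unlock; apply: le_lt_trans Z2 _; rewrite ltry.
split=> //; have := Z2.
have [_ LZZ] := LZ2; rewrite -[leLHS]fineK ?integrable_fin_num// lee_fin.
Qed.

Lemma cond_exp_orthogonal u Y Z W : in_L2 P Y ->
  is_cond_exp P (sigma_sub X u) Y Z ->
  (forall C : set R, measurable C -> sigma_sub X u (W @^-1` C)) -> in_L2 P W ->
  << fun t => Y t - Z t, W >> = 0.
Proof.
move=> LY hZ mW LW; have [LZ _] := cond_exp_in_L2 LY hZ.
have LD := in_L2B LY LZ.
apply: (@integral_sigma_sub_mul_eq0 _ _ _ P d X u) => //.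
- exact: in_L2_L1.
- by move=> B; apply: integral_cond_expB => //; exact: in_L2_L1.
- exact: in_L1M.
Qed.

Hypothesis indep : independent X.
Variables (Y : T -> R) (h Z : {set 'I_d} -> T -> R).
Hypotheses (LY : in_L2 P Y)
  (hZ : forall u, is_cond_exp P (sigma_sub X u) Y (Z u))
  (hE : forall u t, h u t = Z u t - \sum_(w : {set 'I_d} | w \proper u) h w t).

Let LZ u : in_L2 P (Z u). Proof. by have [] := cond_exp_in_L2 LY (hZ u). Qed.

Let mZ u : forall C : set R, measurable C -> sigma_sub X u (Z u @^-1` C).
Proof. by have [] := hZ u. Qed.

(** The recursion read backwards: conditional expectations are sums of [h] over all subsets. *)
Let ZE u t : Z u t = \sum_(w : {set 'I_d} | w \subset u) h w t.
Proof.
rewrite (bigD1 u)//= hE; rewrite [X in _ = _ - X + _](eq_bigl (fun w => (w \subset u) && (w != u))).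
  by rewrite subrK.
by move=> w; rewrite finset.properEneq andbC.
Qed.

Let Lh u : in_L2 P (h u).
Proof.
have [n] := ubnP #|u|; elim: n u => // n IH u; rewrite ltnS => un.
have -> : h u = fun t => Z u t - \sum_(w : {set 'I_d} | w \proper u) h w t.
  by apply/funext => t; exact: hE.
apply: in_L2B => //; apply: in_L2_sum => w wu; apply: IH.
exact: leq_trans (proper_card wu) un.
Qed.

(** [Z u - Z (u :&: w)] integrates to zero over the events of [X_w], hence is orthogonal to
    [Z w]. *)
Let ZZ u w : << Z u, Z w >> = << Z (u :&: w), Z w >>.
Proof.
apply/eqP; rewrite -subr_eq0 -scalar_productBl//; apply/eqP.
have LD := in_L2B (LZ u) (LZ (u :&: w)).
apply: (@integral_sigma_sub_mul_eq0 _ _ _ P d X w) => //.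
- exact: in_L2_L1.
- exact: (cond_exp_setI indep (hZ u) (hZ (u :&: w))).
- exact: mZ.
- exact: in_L1M.
Qed.

(** Induction on the cardinality of [u]. In the subtracted sum, terms not inside [w] vanish; the
    others run over all subsets of [u :&: w], because [u] is not inside [w], and add up to
    [Z (u :&: w)], whose product with [Z w] is that of [Z u]. *)
Let hZ0 u w : ~~ (u \subset w) -> << h u, Z w >> = 0.
Proof.
have [n] := ubnP #|u|; elim: n u => // n IH u; rewrite ltnS => un uw.
have -> : h u = fun t => Z u t - \sum_(v : {set 'I_d} | v \proper u) h v t.
  by apply/funext => t; exact: hE.
rewrite scalar_productBl//; last exact: in_L2_sum.
rewrite scalar_product_suml// (bigID (fun v : {set 'I_d} => v \subset w))/=.
rewrite [X in _ - (_ + X)]big1 ?addr0; last first.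
  by move=> v /andP[vu vw]; apply: IH => //; exact: leq_trans (proper_card vu) un.
rewrite ZZ (_ : Z (u :&: w) = fun t => \sum_(v : {set 'I_d} | v \subset u :&: w) h v t); last first.
  by apply/funext => t; exact: ZE.
rewrite scalar_product_suml//; apply/eqP; rewrite subr_eq0; apply/eqP.
apply: eq_bigl => v; rewrite finset.subsetI.
case: (boolP (v \subset w)) => vw; rewrite ?andbF// !andbT.
rewrite finset.properEneq; case: eqP => //= vu.
by move: uw; rewrite -vu vw.
Qed.

(** Induction on the cardinality of [w], whose proper subsets do not contain [u] either. *)
Let hh0_subset u w : ~~ (u \subset w) -> << h u, h w >> = 0.
Proof.
have [n] := ubnP #|w|; elim: n w => // n IH w; rewrite ltnS => wn uw.
rewrite (_ : h w = fun t => Z w t - \sum_(v : {set 'I_d} | v \proper w) h v t); last first.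
  by apply/funext => t; exact: hE.
rewrite scalar_productBr//; last exact: in_L2_sum.
rewrite hZ0// scalar_product_sumr// big1 ?subr0// => v vw; apply: IH.
  exact: leq_trans (proper_card vw) wn.
by apply: contra uw => uv; exact: fintype.subset_trans uv (proper_sub vw).
Qed.

Let hh0 u w : u != w -> << h u, h w >> = 0.
Proof.
rewrite finset.eqEsubset negb_and => /orP[]; first exact: hh0_subset.
by move=> wu; rewrite scalar_productC hh0_subset.
Qed.

(** With [J] the complement of [j] and squared norms written as squares, orthogonality gives the
    total index as [Z_all^2 - Z_J^2], at most [Y^2 - Z_J^2]. Since [Y] and [Z_J] have the same
    product with [W], nonnegativity of [(Z_J - W)^2] bounds this by [(Y - W)^2]. *)
Lemma sobol_total_le (j : 'I_d) W :
  (forall C : set R, measurable C -> sigma_sub X [set~ j]%SET (W @^-1` C)) ->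
  in_L2 P W ->
  (sobol_total P h j <= 'E_P[fun t => ((Y t - W t) ^+ 2)%R])%E.
Proof.
move=> mW LW; pose J := [set~ j]%SET.
have LYW := in_L2B LY LW.
rewrite /sobol_total expectation_sqr//.
under eq_bigr do rewrite expectation_sqr//.
rewrite sumEFin lee_fin.
pose V t := \sum_(w : {set 'I_d} | j \in w) h w t.
have LV : in_L2 P V by exact: in_L2_sum.
(* The sets avoiding [j] are the subsets of [J], and their terms add up to [Z J]. *)
have VE : V = fun t => Z [set: 'I_d]%SET t - Z J t.
  apply/funext => t; rewrite !ZE.
  rewrite [X in _ = X - _](bigID (fun w : {set 'I_d} => j \in w))/=.
  rewrite [X in _ = X + _ - _](eq_bigl (fun w : {set 'I_d} => j \in w)); last first.
    by move=> w; rewrite finset.subsetT.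
  rewrite [X in _ = _ + X - _](eq_bigl (fun w : {set 'I_d} => w \subset J)) ?addrK//.
  move=> w; rewrite finset.subsetT/= /J.
  apply/idP/idP => [jw|/fintype.subsetP wJ].
    by apply/fintype.subsetP => i iw; rewrite !inE; apply: contraNneq jw => <-.
  by apply/negP => /wJ; rewrite !inE eqxx.
have -> : \sum_(w : {set 'I_d} | j \in w) << h w, h w >> = << V, V >>.
  rewrite scalar_product_suml//; apply: eq_bigr => w jw.
  rewrite scalar_product_sumr// (bigD1 w)//= big1 ?addr0// => i /andP[_ iw].
  by rewrite hh0// eq_sym.
have VV : << V, V >> = << Z [set: 'I_d]%SET, Z [set: 'I_d]%SET >> - << Z J, Z J >>.
  have e : << Z [set: 'I_d]%SET, Z J >> = << Z J, Z J >> by rewrite ZZ finset.setTI.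
  rewrite VE scalar_productBl//; last exact: in_L2B.
  rewrite !scalar_productBr// e (scalar_productC P (Z J)) e; lra.
have [_ ZY] := cond_exp_in_L2 LY (hZ [set: 'I_d]%SET).
have YZ : << Y, Z J >> = << Z J, Z J >>.
  apply/eqP; rewrite -subr_eq0 -scalar_productBl//; apply/eqP.
  exact: (cond_exp_orthogonal LY (hZ J) (@mZ J) (LZ J)).
have YW : << Y, W >> = << Z J, W >>.
  apply/eqP; rewrite -subr_eq0 -scalar_productBl//; apply/eqP.
  exact: (cond_exp_orthogonal LY (hZ J) mW LW).
have := scalar_product_ge0 P (fun t => Z J t - W t).
have LZW := in_L2B (LZ J) LW.
rewrite !scalar_productBl// !scalar_productBr//.
rewrite (scalar_productC P W (Z J)) (scalar_productC P W Y) YW; lra.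
Qed.

End hoeffding_decomposition.

(** * Freezing one coordinate *)

Section continuous_row.
Context {R : realType} {d0 : measure_display} {S : measurableType d0} {d : nat}.

(** No condition on [g] is imposed: any subset of [K] is a countable union of points, enumerated by
    [unpickle]. *)
Lemma measurable_countable_comp (K : countType) (k : S -> K) (g : K -> R) :
  (forall a, measurable (k @^-1` [set a])) -> measurable_fun [set: S] (g \o k).
Proof.
move=> mk _ B mB; rewrite setTI.
rewrite (_ : _ @^-1` B = \bigcup_n (if unpickle n is Some a then
    if g a \in B then k @^-1` [set a] else set0 else set0)).
  by apply: bigcupT_measurable => n; case: unpickle => // a; case: ifP.
apply/seteqP; split=> s /=.
  by move=> Bs; exists (pickle (k s)) => //; rewrite pickleK mem_set.
by move=> [n _]; case: unpickle => // a; case: ifPn => //; rewrite inE => Ba /= ->.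
Qed.

(* [f (Phi s)] is the limit of [f] along the grid points
   [floor ((n + 1) Phi s) / (n + 1)], which take countably many values. *)
Lemma measurable_continuous_row (f : 'rV[R]_d -> R) (Phi : 'I_d -> S -> R) :
  continuous f -> (forall i, measurable_fun [set: S] (Phi i)) ->
  measurable_fun [set: S] (fun s => f (\row_i Phi i s)).
Proof.
move=> cf mPhi.
pose k (n : nat) (s : S) := [ffun i : 'I_d => Num.floor (n.+1%:R * Phi i s)].
pose G n (a : {ffun 'I_d -> int}) := f (\row_i ((a i)%:~R / n.+1%:R)).
apply: (measurable_fun_cvg (h := fun n => G n \o k n)) => [n|s _].
  apply: measurable_countable_comp => a.
  rewrite (_ : _ @^-1` _ = \bigcap_(i in [set: 'I_d])
      ((fun s => n.+1%:R * Phi i s) @^-1` `[(a i)%:~R, (a i + 1)%:~R[)).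
    apply: fin_bigcap_measurable => [|i _]; first exact: finite_finset.
    rewrite -[X in measurable X]setTI.
    have : measurable_fun [set: S] (fun s => n.+1%:R * Phi i s).
      by apply: measurable_funM => //; exact: mPhi.
    by apply.
  apply/seteqP; split=> s /=.
    by move=> <- i _ /=; rewrite ffunE in_itv/= floor_itv.
  move=> H; apply/ffunP => i; rewrite ffunE; apply: floor_def.
  by have := H i I; rewrite /= in_itv.
apply/cvgrPdist_lt => e e0.
have /cvgrPdist_lt /(_ _ e0) /nbhs_ballP [r /= r0 H] := cf (\row_i Phi i s).
(* Rounding down moves each coordinate by less than [1 / (n + 1)], eventually below the radius
   [r]. *)
near=> n; apply: H; split=> // a i; rewrite /ball/= !mxE ffunE.
have n0 : 0 < n.+1%:R :> R by [].
have /andP[fl fu] := floor_itv (n.+1%:R * Phi i s).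
set z := Num.floor _ in fl fu *.
have zn : z%:~R / n.+1%:R <= Phi i s by rewrite ler_pdivrMr// mulrC.
rewrite ger0_norm ?subr_ge0//.
apply: (@lt_trans _ _ n.+1%:R^-1); last by near: n; exact: near_infty_natSinv_lt (PosNum r0).
rewrite ltrBlDr -(ltr_pM2l n0) mulrDr divff ?gt_eqF// mulrCA divff ?gt_eqF// mulr1.
by rewrite addrC; move: fu; rewrite intrD.
Unshelve. all: by end_near. Qed.

End continuous_row.

Section replace_coordinate.
Context {R : realType} {d : nat}.
Implicit Types (f : 'rV[R]_d -> R) (r : 'rV[R]_d) (j : 'I_d).

Definition set_coord r j (x : R) : 'rV[R]_d := \row_i (if i == j then x else r 0 i).

Lemma set_coord_shift r j (h x : R) :
  set_coord r j (h + x) = h *: delta_mx 0 j + set_coord r j x.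
Proof.
apply/rowP => i; rewrite !mxE eqxx/=; case: eqP => _.
  by rewrite mulr1.
by rewrite mulr0 add0r.
Qed.

Lemma set_coord_id r j : set_coord r j (r 0 j) = r.
Proof. by apply/rowP => i; rewrite mxE; case: eqP => // ->. Qed.

(** The difference quotients of the one-variable section and of the directional derivative are the
    same function, so existence and value of the limit transfer together. *)
Let section_quotient f r j (x : R) :
  (fun h : R => h^-1 *: (((fun y => f (set_coord r j y)) \o shift x) (h *: 1) -
     f (set_coord r j x))) =
  (fun h => h^-1 *: ((f \o shift (set_coord r j x)) (h *: delta_mx 0 j) -
     f (set_coord r j x))).
Proof. by apply/funext => h /=; rewrite [h%:A]mulr1 set_coord_shift. Qed.

Lemma derivable_set_coord f r j (x : R) : differentiable f (set_coord r j x) ->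
  derivable (fun y => f (set_coord r j y)) x 1.
Proof.
move=> df; rewrite /derivable section_quotient.
exact: diff_derivable.
Qed.

Lemma derive1_set_coord f r j (x : R) :
  derive1 (fun y => f (set_coord r j y)) x = partial f j (set_coord r j x).
Proof. by rewrite derive1E /derive section_quotient. Qed.

End replace_coordinate.

(** * Fubini between [X j] and the other coordinates *)

Section transport.
Context {R : realType} {dT : measure_display} {T : measurableType dT}.
Variables (P : probability T R) (d : nat) (X : 'I_d -> {RV P >-> R}) (j : 'I_d).
Hypothesis indep : independent X.

Local Notation J := [set~ j]%SET.
Local Notation gens := (\bigcup_(i in [set i | i \in J])
        preimage_set_system [set: T] (X i) (@measurable _ R)).
Local Notation TG := (g_sigma_algebraType gens).

Let mid : measurable_fun [set: T] (id : T -> TG).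
Proof. by move=> _ A mA; rewrite setTI; exact: (@sigma_sub_measurable _ _ _ P d X J). Qed.

Let mpair : measurable_fun [set: T] ((fun t => (X j t, t)) : T -> R * TG).
Proof. by apply/measurable_fun_pairP; split; [exact: measurable_funP|exact: mid]. Qed.

Let idG : {mfun T >-> TG} := mfun_Sub (mem_set mid).
Let pairG : {mfun T >-> (R * TG)%type} := mfun_Sub (mem_set mpair).

(** [T] itself, with the sigma-algebra of the other coordinates, serves as second factor. By
    independence the law of [(X j t, t)] is a product on rectangles, hence everywhere. *)
Lemma integral_independent_coord (F : R * TG -> \bar R) :
  measurable_fun [set: R * TG] F -> (forall z, 0 <= F z)%E ->
  (\int[P]_t F (X j t, t) =
   \int[distribution P idG]_t \int[distribution P (X j)]_x F (x, t))%E.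
Proof.
move=> mF F0.
have E := @product_measure_unique _ _ _ _ _ (distribution P (X j))
  (distribution P idG) (distribution P pairG).
rewrite -fubini_tonelli2//.
rewrite (eq_measure_integral (distribution P pairG)); last first.
  move=> A mA _; apply: E => // B C mB mC.
  pose A' (i : 'I_d) := B.
  have := @sigma_sub_indep _ _ _ P d X indep J [set j]%SET A' C.
  have -> : cylinder X [set j]%SET A' = X j @^-1` B.
    apply/seteqP; split=> t /= H; first by apply: H; rewrite /= inE.
    by move=> i /=; rewrite inE => /eqP ->.
  by apply => // i; rewrite !inE.
by rewrite ge0_integral_pushforward.
Qed.

Lemma measurable_coord (Phi : 'I_d -> R * TG -> R) :
  measurable_fun [set: R * TG] (Phi j) ->
  (forall i, i != j -> forall z, Phi i z = X i z.2) ->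
  forall i, measurable_fun [set: R * TG] (Phi i).
Proof.
move=> mj H i; have [->//|ij] := eqVneq i j.
rewrite (funext (H i ij)).
apply: (@measurableT_comp _ _ _ _ _ _ (X i : TG -> R)) => //.
move=> _ B mB; rewrite setTI; apply: preimage_sigma_sub => //.
by rewrite !inE.
Qed.

Variables (f : 'rV[R]_d -> R) (m C : R).
Hypotheses (df : forall x, differentiable f x) (C0 : 0 <= C).
Hypothesis poincare : forall g : R -> R, (forall x, derivable g x 1) ->
  (\int[distribution P (X j)]_x ((g x - g m) ^+ 2)%:E <=
   C%:E * \int[distribution P (X j)]_x (derive1 g x ^+ 2)%:E)%E.

Let cf : continuous f.
Proof. by move=> x; exact: differentiable_continuous. Qed.

Let fX (s : R * T) : R := f (set_coord (random_vector X s.2) j s.1).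

Let mfX (k : R -> R) : measurable_fun [set: R] k ->
  measurable_fun [set: R * TG] ((fun s => fX (k s.1, s.2)) : R * TG -> R).
Proof.
move=> mk; pose Phi (i : 'I_d) (s : R * TG) := if i == j then k s.1 else X i s.2.
rewrite (_ : (fun s => _) = fun s => f (\row_i Phi i s)).
  apply: measurable_continuous_row => //; apply: measurable_coord.
    rewrite /Phi eqxx; exact: measurableT_comp.
  by move=> i ij s; rewrite /Phi (negbTE ij).
apply/funext => s; congr f; apply/rowP => i; rewrite !mxE /Phi.
by case: ifP.
Qed.

Lemma sigma_sub_set_coord (B : set R) : measurable B ->
  sigma_sub X J ((fun t => f (set_coord (random_vector X t) j m)) @^-1` B).
Proof.
move=> mB.
have mW : measurable_fun [set: TG] ((fun t => fX (m, t)) : TG -> R).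
  apply: (@measurableT_comp _ _ _ _ _ _ _ _ (fun t : TG => (m, t)) (mfX (measurable_cst m))).
  exact: measurable_pair1.
by have := mW measurableT B mB; rewrite setTI.
Qed.

Lemma expectation_set_coord_le :
  ('E_P[fun t => ((f (random_vector X t) -
       f (set_coord (random_vector X t) j m)) ^+ 2)%R] <=
   C%:E * 'E_P[fun t => (partial f j (random_vector X t) ^+ 2)%R])%E.
Proof.
have XE t : set_coord (random_vector X t) j (X j t) = random_vector X t.
  by rewrite -[RHS](set_coord_id _ j) mxE.
pose F1 (z : R * TG) := (((fX z - fX (m, z.2)) ^+ 2)%:E : \bar R).
pose F2 (z : R * TG) := ((partial f j (set_coord (random_vector X z.2) j z.1) ^+ 2)%:E : \bar R).
have mF1 : measurable_fun [set: R * TG] F1.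
  apply/measurable_EFinP; apply: measurable_funX; apply: measurable_funB.
    exact: (mfX (k := id)).
  exact: (mfX (measurable_cst m)).
have mF2 : measurable_fun [set: R * TG] F2.
  apply/measurable_EFinP; apply: measurable_funX.
  (* Joint measurability of the partial derivative, as the limit of its difference quotients. *)
  pose q (n : nat) (z : R * TG) := n.+1%:R * (fX (n.+1%:R^-1 + z.1, z.2) - fX (id z.1, z.2)).
  apply: (measurable_fun_cvg (h := q)) => [n|z _].
    apply: measurable_funM => //; apply: measurable_funB; last exact: (mfX (k := id)).
    apply: (mfX (k := fun x => n.+1%:R^-1 + x)).
    by apply: measurable_funD => //; exact: measurable_cst.
  rewrite -derive1_set_coord; apply: cvg_derive1_harmonic.
  exact: derivable_set_coord.
have F10 z : (0 <= F1 z)%E by rewrite lee_fin sqr_ge0.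
have F20 z : (0 <= F2 z)%E by rewrite lee_fin sqr_ge0.
rewrite unlock.
have -> : (\int[P]_t ((f (random_vector X t) -
     f (set_coord (random_vector X t) j m)) ^+ 2)%:E = \int[P]_t F1 (X j t, t))%E.
  by apply: eq_integral => t _; rewrite /F1 /fX /= XE.
have -> : (\int[P]_t (partial f j (random_vector X t) ^+ 2)%:E =
    \int[P]_t F2 (X j t, t))%E.
  by apply: eq_integral => t _; rewrite /F2 /= XE.
rewrite !integral_independent_coord//.
have mG2 := (@measurable_fun_fubini_tonelli_G _ _ R TG R (distribution P (X j)) _ mF2 F20).
rewrite -ge0_integralZl_EFin//; last by move=> t _; exact: integral_ge0.
apply: ge0_le_integral => //.
- by move=> t _; exact: integral_ge0.
- exact: (@measurable_fun_fubini_tonelli_G _ _ R TG R (distribution P (X j)) _ mF1 F10).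
- exact: measurable_funeM.
(* With the other coordinates fixed, the one-dimensional inequality applies to the section of
   [f]. *)
move=> t _; pose g x := fX (x, t).
have dg x : derivable g x 1.
  exact: (@derivable_set_coord _ _ f (random_vector X t) j x (df _)).
have F2E : (\int[distribution P (X j)]_x F2 (x, t) =
    \int[distribution P (X j)]_x (derive1 g x ^+ 2)%:E)%E.
  by apply: eq_integral => x _; rewrite /F2 /= -derive1_set_coord.
rewrite F2E; exact: (poincare dg).
Qed.

End transport.

(** * Total Sobol' index against the derivative-based measure *)

Unset Implicit Arguments.

Theorem theorem3p2 (R : realType) (dT : measure_display) (T : measurableType dT)
    (P : probability T R) (d : nat) (X : 'I_d -> {RV P >-> R})
    (f : 'rV[R]_d -> R) (j : 'I_d) (c : R) (v : R -> R) (m : R)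
    (h : {set 'I_d} -> T -> R)
    (f_differentiable : forall x : 'rV[R]_d, differentiable f x)
    (A1 : independent X)
    (A2 : ('E_P[fun t => (f (random_vector X t) ^+ 2)%R] < +oo)%E)
    (A3 : ('E_P[fun t => (partial f j (random_vector X t) ^+ 2)%R] < +oo)%E)
    (A5 : log_concave (distribution P (X j)) c v)
    (m_median : is_median (distribution P (X j)) m)
    (h_hoeffding : hoeffding X (fun t => f (random_vector X t)) h) :
  (sobol_total P h j <= ((expR (v m) / c) ^+ 2)%:E * dgsm X f j)%E /\
  cheeger (distribution P (X j)) (boltzmann_density c v) =
    (expR (v m) / c / 2)%:E.
Proof.
split; last exact: log_concave_cheeger.
pose Y t := f (random_vector X t).
pose W t := f (set_coord (random_vector X t) j m).
have cf : continuous f by move=> x; exact: differentiable_continuous.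
have mY : measurable_fun [set: T] Y.
  exact: (measurable_continuous_row cf (fun i => measurable_funP (X i))).
have mW := @sigma_sub_set_coord _ _ _ P d X j f m f_differentiable.
have mWT : measurable_fun [set: T] W.
  by apply: (@sigma_sub_measurable_fun _ _ _ P d X [set~ j]%SET).
have K0 : 0 <= (expR (v m) / c) ^+ 2 by exact: sqr_ge0.
have YW := expectation_set_coord_le A1 f_differentiable K0
  (log_concave_poincare A5 m_median).
have LY : in_L2 P Y by exact: in_L2P.
(* Square integrability of [W] is not assumed: the Poincare bound and [A3] give it for [Y - W], and
   then [W = Y - (Y - W)]. *)
have LYW : in_L2 P (fun t => Y t - W t).
  apply: in_L2P; first exact: measurable_funB.
  apply: le_lt_trans YW _; apply: lte_mul_pinfty => //.
have LW : in_L2 P W.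
  have := in_L2B LY LYW; congr (in_L2 P _); apply/funext => t.
  by rewrite opprB addrC subrK.
have /choice[Z hZ] : forall u, exists Z,
    is_cond_exp P (sigma_sub X u) Y Z /\
    (forall t, h u t = Z t - \sum_(w : {set 'I_d} | w \proper u) h w t).
  by move=> u; have [Z hZ hE] := h_hoeffding u; exists Z.
apply: le_trans YW.
exact: (sobol_total_le A1 LY (fun u => (hZ u).1) (fun u => (hZ u).2) mW LW).
Qed.
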